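(* Let $m\ge 2$, $n_1\ge 1,\ldots,n_m\ge 1$ be integers and $n=n_1+\cdots+n_m$. Let $K_{n_1,\ldots,n_m}$ be the complete multipartite graph of type $(n_1,\ldots,n_m)$ on $\{x_1,\ldots,x_n\}=V_1\sqcup\cdots\sqcup V_m$. Let $M$ be a (possibly empty) matching of $K_{n_1,\ldots,n_m}$ such that the graph $G:=K_{n_1,\ldots,n_m}-M$ has no isolated vertex. Let $\mathfrak{c}=(c_1,\ldots,c_n)\in\mathbb{N}^n$ and set $$\ell_i:=\sum_{x_h\in V_i}c_h\quad(1\le i\le m).$$ Furthermore, set $$d_k:=\min\Big\{c_k,\ \sum_{x_\ell\in N_G(x_k)}c_\ell\Big\}\quad(1\le k\le n).$$ For an edge $\{x_k,x_{k'}\}\in M$ consider the condition $$( * )\qquad c_k>\sum_{\substack{x_t\in N_G(x_k)\\ x_t\notin N_G(x_{k'})}}c_t,\qquad c_{k'}>\sum_{\substack{x_t\in N_G(x_{k'})\\ x_t\notin N_G(x_k)}}c_t,\qquad c_k+c_{k'}\ge\sum_{\substack{1\le t\le n\\ t\ne k,k'}}c_t+2 .$$ ($\alpha$) If there is $\{x_k,x_{k'}\}\in M$ for which $( * )$ holds, then $\mathcal{B}(\mathfrak{c},G)\cong A(d;\mathfrak{f})$, where $$d=\sum_{\substack{1\le t\le n\\ t\ne k,k'}}c_t-\sum_{x_t\in N_G(x_k)\setminus N_G(x_{k'})}c_t-\sum_{x_t\in N_G(x_{k'})\setminus N_G(x_k)}c_t$$ and $\mathfrak{f}=(f_1,f_2)$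 with $$f_1:=\min\Big\{c_k-\sum_{x_t\in N_G(x_k)\setminus N_G(x_{k'})}c_t,\ d\Big\},\qquad f_2:=\min\Big\{c_{k'}-\sum_{x_t\in N_G(x_{k'})\setminus N_G(x_k)}c_t,\ d\Big\}.$$ ($\beta$) Suppose that $( * )$ fails to be satisfied for every edge $\{x_k,x_{k'}\}\in M$. (i) If $\ell_i-2<\sum_{1\le j\le m,\ j\ne i}\ell_j$ for every $1\le i\le m$, then $\mathcal{B}(\mathfrak{c},G)$ is a polynomial ring in at most $n$ variables, and hence it is Gorenstein. (ii) If there is $1\le i\le m$ with $\ell_i-2\ge\sum_{1\le j\le m,\ j\ne i}\ell_j$, then $\mathcal{B}(\mathfrak{c},G)\cong A(d;\mathfrak{b})$, where $$d=\sum_{\substack{1\le j\le m\\ j\ne i}}\ell_j,\qquad \mathfrak{b}=(d_{n_1+\cdots+n_{i-1}+1},\ldots,d_{n_1+\cdots+n_i})\in\mathbb{N}^{n_i}.$$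
   Context: $\mathbb{N}$ denotes the set of positive integers, $K$ is a field and $S=K[x_1,\ldots,x_n]$ is the polynomial ring. For a monomial ideal $I\subset S$ and $\mathfrak{c}=(c_1,\ldots,c_n)\in\mathbb{N}^n$, $I_{\mathfrak{c}}$ is the ideal generated by those monomials $x_1^{a_1}\cdots x_n^{a_n}\in I$ with $a_i\le c_i$ for all $i$; $\delta_{\mathfrak{c}}(I)$ is the largest integer $q$ for which $(I^q)_{\mathfrak{c}}\neq 0$. For a finite graph $G$ on $\{x_1,\ldots,x_n\}$ (no loop, no multiple edge, no isolated vertex), its edge ideal $I(G)\subset S$ is generated by the monomials $x_ix_j$ with $\{x_i,x_j\}\in E(G)$. If $\{w_1,\ldots,w_s\}$ is the minimal set of monomial generators of $(I(G)^{\delta})_{\mathfrak{c}}$ with $\delta=\delta_{\mathfrak{c}}(I(G))$, then $\mathcal{B}(\mathfrak{c},G)$ is the toric ring $K[w_1,\ldots,w_s]\subset S$. With $V_i=\{x_{n_1+\cdots+n_{i-1}+1},\ldots,x_{n_1+\cdots+n_i}\}$ for $1\le i\le m$, the complete multipartite graph $K_{n_1,\ldots,n_m}$ has vertex set $V_1\sqcup\cdots\sqcup V_m$ and edges all $\{x_k,x_\ell\}$ with $x_k\in V_i$, $x_\ell\in V_j$, $1\le i<j\le m$. A matching of a graph is a set of pairwise disjoint edges. For a matching $M$ of a graph $H$, $H-M$ is the graph obtained from $H$ by removing all edges belonging to $M$ (keeping all vertices). $N_G(x)$ is the set of vertices adjacent to $x$ in $G$. For a positive integer $d$ and a vector $\mathfrak{a}=(a_1,\ldots,a_r)\in\mathbb{N}^r$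 with $1\le a_i\le d$ for all $i$ and $d\le\sum_{i=1}^r a_i$, the algebra of Veronese type $A(d;\mathfrak{a})$ is the toric ring over $K$ generated by those monomials $x_1^{q_1}\cdots x_r^{q_r}$ with $q_i\le a_i$ for each $i$ and $\sum_{i=1}^r q_i=d$.
   Formalization: In (α) the formal statement additionally assumes d > 0; for m = 2 condition ( * ) always gives d = 0, where A(d; f) is not defined (e.g. type (2,2), M = {{x1,x3}}, c = (2,1,2,1)), and for m ≥ 3 one always has d > 0. *)

(* Defs.v *)
From HB Require Import structures.
From mathcomp Require Import all_boot all_order all_algebra.
From mathcomp Require Import mpoly.
From mathcomp Require Import boolp.
From mathcomp Require classical_sets.

Set Implicit Arguments.
Unset Strict Implicit.
Unset Printing Implicit Defensive.

Import GRing.Theory.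

(* Ideals of a commutative ring are represented by Prop-valued predicates. *)

Section Ideals.
Local Open Scope ring_scope.
Variable R : comNzRingType.
Implicit Types I J X : R -> Prop.

Definition is_ideal I : Prop :=
  [/\ I 0, (forall x y, I x -> I y -> I (x + y)) & (forall a x, I x -> I (a * x))].

Definition ideal_gen X : R -> Prop := fun p =>
  exists (s : nat) (a x : 'I_s -> R),
    (forall i, X (x i)) /\ p = \sum_(i < s) a i * x i.

(* For q = 0 the only generator is the empty product, so that I^0 = R. *)
Definition ideal_pow I (q : nat) : R -> Prop :=
  ideal_gen (fun p => exists x : 'I_q -> R,
    (forall i, I (x i)) /\ p = \prod_(i < q) x i).

Definition ideal_eq I J : Prop := forall p, I p <-> J p.

Definition ideal_nonzero I : Prop := exists p, I p /\ p != 0.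

Definition maximal_ideal I : Prop :=
  [/\ is_ideal I, ~ I 1 &
      forall J, is_ideal J -> (forall x, I x -> J x) -> J 1 \/ ideal_eq J I].

Definition noetherian : Prop :=
  forall I, is_ideal I -> exists s : seq R, ideal_eq I (ideal_gen (fun x => x \in s)).

End Ideals.

Section Gorenstein.
Local Open Scope ring_scope.

Definition nonunit (R : comNzRingType) : R -> Prop :=
  fun x => ~ exists y, x * y = 1.

(* L, together with phi, is a localization of R at the prime ideal p. *)
Definition is_localization (R : comNzRingType) (p : R -> Prop)
    (L : comNzRingType) (phi : {rmorphism R -> L}) : Prop :=
  [/\ (forall s, ~ p s -> exists u, phi s * u = 1),
      (forall x : L, exists a s, ~ p s /\ x * phi s = phi a) &
      (forall a, phi a = 0 -> exists s, ~ p s /\ s * a = 0)].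

Definition regular_sequence (R : comNzRingType) (xs : seq R) : Prop :=
  (forall i y, (i < size xs)%N ->
     ideal_gen (fun z => z \in take i xs) (xs`_i * y) ->
     ideal_gen (fun z => z \in take i xs) y) /\
  ~ ideal_gen (fun z => z \in xs) 1.

(* For a Noetherian local ring L, whose maximal ideal n consists of its
   nonunits: L is Cohen-Macaulay of type one, that is, some system of parameters
   xs of L (some power of n lies in (xs)) is a regular sequence, and the socle
   ((xs) : n) / (xs) of L / (xs) is one-dimensional over L / n, spanned by the
   class of u. *)
Definition gorenstein_local (L : comNzRingType) : Prop :=
  exists xs : seq L,
    let J := ideal_gen (fun z => z \in xs) in
    let in_socle v := forall a, nonunit a -> J (a * v) in
    [/\ (forall x, x \in xs -> nonunit x),
        regular_sequence xs,
        (exists q, forall y, ideal_pow (@nonunit L) q y -> J y) &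
        exists u, [/\ ~ J u, in_socle u &
          forall v, in_socle v -> exists b, J (v - b * u)]].

Definition gorenstein (R : comNzRingType) : Prop :=
  noetherian R /\
  forall (p : R -> Prop), maximal_ideal p ->
  forall (L : comNzRingType) (phi : {rmorphism R -> L}),
    is_localization p phi -> gorenstein_local L.

End Gorenstein.

(* The toric ring K[X^w : w in W], as a K-subalgebra of the polynomial ring. *)

Section Toric.
Local Open Scope ring_scope.
Variables (K : fieldType) (n : nat) (W : 'X_{1..n} -> Prop).

(* The smallest K-subalgebra containing the monomials X^w, w in W. *)
Definition toric_pred : {pred {mpoly K[n]}} := fun p =>
  `[< forall A : {pred {mpoly K[n]}}, subalg_closed A ->
        (forall w, W w -> 'X_[w] \in A) -> p \in A >].

Lemma toric_subalg : subalg_closed toric_pred.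
Proof.
split=> [|a u v /asboolP Hu /asboolP Hv|u v /asboolP Hu /asboolP Hv];
  apply/asboolP => A subA genA; case: (subA) => A1 Alin Amul.
- exact: A1.
- by apply: Alin; [exact: Hu | exact: Hv].
- by apply: Amul; [exact: Hu | exact: Hv].
Qed.

HB.instance Definition _ :=
  GRing.isSubalgClosed.Build K {mpoly K[n]} toric_pred
    (GRing.subalg_closed_semi toric_subalg).

Record toric := Toric { toric_val : {mpoly K[n]}; _ : toric_val \in toric_pred }.

HB.instance Definition _ := [isSub for toric_val].
HB.instance Definition _ := [Choice of toric by <:].
HB.instance Definition _ := [SubChoice_isSubAlgebra of toric by <:].
HB.instance Definition _ := [SubNzRing_isSubComNzRing of toric by <:].

End Toric.

Definition alg_iso (K : fieldType) (A B : algType K) : Prop :=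
  exists f : {lrmorphism A -> B}, bijective f.

(* Graphs on the vertices x_k, k : 'I_n, given by their sets of edges. *)

Section Graphs.
Variables (n : nat) (E : {set {set 'I_n}}).

Definition nbr (k : 'I_n) : {set 'I_n} := [set l | [set k; l] \in E].

Definition matching (M : {set {set 'I_n}}) : bool := (M \subset E) && trivIset M.

End Graphs.

Section MonomialIdeals.
Local Open Scope ring_scope.
Variables (K : fieldType) (n : nat).
Implicit Types (J : {mpoly K[n]} -> Prop) (c : 'X_{1..n}).

Definition edge_ideal (E : {set {set 'I_n}}) : {mpoly K[n]} -> Prop :=
  ideal_gen (fun p => exists k l, [set k; l] \in E /\ p = 'X_k * 'X_l).

(* I_c *)
Definition bounded_part c J : {mpoly K[n]} -> Prop :=
  ideal_gen (fun p => exists a : 'X_{1..n}, [/\ J 'X_[a], (a <= c)%MM & p = 'X_[a]]).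

Definition bounded_pow c J (q : nat) := bounded_part c (ideal_pow J q).

(* delta_c(I) *)
Definition bounded_pow_max c J : nat :=
  classical_sets.xget 0%N (fun q => ideal_nonzero (bounded_pow c J q) /\
    forall q', ideal_nonzero (bounded_pow c J q') -> (q' <= q)%N).

Definition monomial_gens J (W : 'X_{1..n} -> Prop) : Prop :=
  ideal_eq J (ideal_gen (fun p => exists2 w, W w & p = 'X_[w])).

(* The minimal set of monomial generators of the monomial ideal J, each
   monomial being represented by its exponent vector. *)
Definition minimal_gens J : 'X_{1..n} -> Prop :=
  classical_sets.xget (fun _ => False) (fun W => monomial_gens J W /\
    forall W', (forall w, W' w -> W w) -> monomial_gens J W' ->
      forall w, W w -> W' w).

(* B(c, G), for the graph G with edge set E *)
Definition bounded_toric c (E : {set {set 'I_n}}) : comAlgType K :=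
  toric K (minimal_gens
    (bounded_pow c (edge_ideal E) (bounded_pow_max c (edge_ideal E)))).

End MonomialIdeals.

Section Veronese.
Variables (K : fieldType) (r : nat).

(* The range of (d, a) for which A(d; a) is considered *)
Definition veronese_type (d : nat) (a : 'X_{1..r}) : Prop :=
  [/\ 0 < d, (forall i, 1 <= a i <= d) & d <= \sum_(i < r) a i].

Definition veronese (d : nat) (a : 'X_{1..r}) : comAlgType K :=
  toric K (fun q : 'X_{1..r} => (q <= a)%MM /\ \sum_(i < r) q i = d).

End Veronese.

Section Multipartite.
Variables (m : nat) (ns : 'I_m -> nat).

Definition offset (i : 'I_m) : nat := \sum_(j < m | j < i) ns j.

Lemma offset_lt (i : 'I_m) (h : 'I_(ns i)) : offset i + h < \sum_(j < m) ns j.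
Proof.
rewrite (bigID (fun j : 'I_m => j < i)) /= -/(offset i) ltn_add2l.
by rewrite (bigD1 i) ?ltnn //= (leq_trans (ltn_ord h)) ?leq_addr.
Qed.

Definition part_vertex (i : 'I_m) (h : 'I_(ns i)) : 'I_(\sum_(j < m) ns j) :=
  Ordinal (offset_lt h).

(* V_i *)
Definition part (i : 'I_m) : {set 'I_(\sum_(j < m) ns j)} :=
  [set part_vertex h | h : 'I_(ns i)].

Definition multipartite_edges : {set {set 'I_(\sum_(j < m) ns j)}} :=
  \bigcup_(i < m) \bigcup_(j < m | i < j) [set [set k; l] | k in part i, l in part j].

End Multipartite.

(* Main.v *)
Require Import Defs.
From HB Require Import structures.
From mathcomp Require Import all_boot all_order all_algebra.
From mathcomp Require Import mpoly.
From mathcomp Require Import boolp.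
From mathcomp Require Import ssrcomplements zify ring.

Set Implicit Arguments.
Unset Strict Implicit.
Unset Printing Implicit Defensive.

Import GRing.Theory.

(* The exponent vectors of the generators of B(c, G) are the degree vectors,
   bounded by c, of multisets of delta edges of G.  Every stable set of G lies in
   a part V_i or in a removed edge {k, k'}, and a vector a with total degree 2q is
   the degree vector of q edges as soon as a(S) <= q for each of these sets S:
   some edge meets all the sets with a(S) = q, so one can remove it and induct.
   If c(S) >= c(V \ S) + 2 for a maximal stable S (the pair {k, k'} in case
   alpha, the part V_i in case beta (ii)), then delta = c(V \ S), the generators
   equal c outside S, and the relations between them are those of a Veronese type
   algebra in the coordinates of S.  Otherwise delta is half the total degree of c
   rounded down, and the generators are x^c, or some of the x^c / x_k, which are
   algebraically independent.
   The polynomial ring is Gorenstein because it is regular: by induction on the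
   number of variables, each prime is generated by a regular sequence up to
   elements outside the prime. *)

(** * Regular rings *)

Section IdealTheory.
Local Open Scope ring_scope.
Variable R : comNzRingType.
Implicit Types I J X P : R -> Prop.

Lemma ideal_gen_incl X x : X x -> ideal_gen X x.
Proof.
move=> Xx; exists 1%N, (fun=> 1), (fun=> x).
by split=> //; rewrite big_ord1 mul1r.
Qed.

Lemma ideal_gen_is_ideal X : is_ideal (ideal_gen X).
Proof.
split.
- by exists 0%N, (fun=> 0), (fun=> 0); split; [case | rewrite big_ord0].
- move=> x y [s [a [u [Xu ->]]]] [t [b [v [Xv ->]]]].
  exists (s + t)%N,
    (fun i => match split i with inl i => a i | inr i => b i end),
    (fun i => match split i with inl i => u i | inr i => v i end).
  split=> [i|]; first by case: (split i).
  rewrite big_split_ord /=; congr (_ + _); apply: eq_bigr => i _.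
    by rewrite (unsplitK (inl i)).
  by rewrite (unsplitK (inr i)).
- move=> a x [s [b [u [Xu ->]]]]; exists s, (fun i => a * b i), u.
  by split=> //; rewrite big_distrr; apply: eq_bigr => i _; rewrite /= mulrA.
Qed.

Lemma ideal_sum I (T : Type) (r : seq T) (Q : pred T) (F : T -> R) :
  is_ideal I -> (forall i, Q i -> I (F i)) -> I (\sum_(i <- r | Q i) F i).
Proof. by move=> [I0 ID _]; apply: big_ind. Qed.

Lemma ideal_mulr I x y : is_ideal I -> I x -> I (x * y).
Proof. by move=> [_ _ IM] Ix; rewrite mulrC; apply: IM. Qed.

Lemma ideal_sub I x y : is_ideal I -> I x -> I y -> I (x - y).
Proof.
by move=> [_ ID IM] Ix Iy; apply: ID => //; rewrite -mulN1r; apply: IM.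
Qed.

Lemma ideal_gen_min X I x :
  is_ideal I -> (forall y, X y -> I y) -> ideal_gen X x -> I x.
Proof.
move=> idI XI [s [a [u [Xu ->]]]]; apply: ideal_sum => // i _.
by case: idI => _ _ IM; apply: IM; apply: XI.
Qed.

Lemma ideal_gen_mono X Y x :
  (forall y, X y -> Y y) -> ideal_gen X x -> ideal_gen Y x.
Proof.
move=> XY; apply: ideal_gen_min (ideal_gen_is_ideal Y) _ => y /XY.
exact: ideal_gen_incl.
Qed.

Definition prime_ideal P : Prop :=
  [/\ is_ideal P, ~ P 1 & forall x y, P (x * y) -> P x \/ P y].

Lemma maximal_ideal_prime P : maximal_ideal P -> prime_ideal P.
Proof.
move=> [idP P1 maxP]; split=> // x y Pxy.
have [Px|nPx] := pselect (P x); [by left | right].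
have [P0 PD PM] := idP.
pose J z := exists a p, P p /\ z = p + a * x.
have idJ : is_ideal J.
  split; first by exists 0, 0; split; rewrite // mul0r addr0.
    move=> _ _ [a [p [Pp ->]]] [b [q [Pq ->]]]; exists (a + b), (p + q).
    by split; [exact: PD | ring].
  move=> b _ [a [p [Pp ->]]]; exists (b * a), (b * p).
  by split; [exact: PM | ring].
have PJ z : P z -> J z by exists 0, z; split; rewrite // mul0r addr0.
have [[a [p [Pp eq1]]]|JP] := maxP J idJ PJ.
  have -> : y = y * p + a * (x * y) by rewrite -[LHS]mulr1 eq1; ring.
  by apply: PD; apply: PM.
by case: nPx; apply/JP; exists 1, 0; split=> //; rewrite mul1r add0r.
Qed.

(* For a sequence in a prime ideal [P]: its images in the localization at [P]
   form a regular sequence generating the maximal ideal. *)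
Definition regular_params P (xs : seq R) : Prop :=
  [/\ forall x, x \in xs -> P x,
      forall i y, (i < size xs)%N ->
        ideal_gen (fun z => z \in take i xs) (xs`_i * y) ->
        exists s, ~ P s /\ ideal_gen (fun z => z \in take i xs) (s * y) &
      forall y, P y -> exists s, ~ P s /\ ideal_gen (fun z => z \in xs) (s * y)].

Lemma common_multiplier P J (n : nat) (F : nat -> R) :
  prime_ideal P -> is_ideal J ->
  (forall i, (i < n)%N -> exists s, ~ P s /\ J (s * F i)) ->
  exists s, ~ P s /\ forall i, (i < n)%N -> J (s * F i).
Proof.
move=> [idP P1 prP] [J0 JD JM].
elim: n => [|n IHn] H; first by exists 1.
have [s [nPs Hs]] := IHn (fun i lt_in => H i (ltnW lt_in)).
have [t [nPt Ht]] := H n (ltnSn n).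
exists (s * t); split; first by case/prP.
move=> i; rewrite ltnS leq_eqVlt => /predU1P[->|/Hs Js].
  by rewrite -mulrA; apply: JM.
by rewrite (mulrC s) -mulrA; apply: JM.
Qed.

End IdealTheory.

Definition regular_ring (R : comNzRingType) : Prop :=
  forall P : R -> Prop, prime_ideal P -> exists xs, regular_params P xs.

Section Morphisms.
Local Open Scope ring_scope.
Variables (A B : comNzRingType) (f : {rmorphism A -> B}).

Lemma preim_is_ideal (I : B -> Prop) : is_ideal I -> is_ideal (fun x => I (f x)).
Proof.
move=> [I0 ID IM]; split=> [|x y Ix Iy|a x Ix].
- by rewrite rmorph0.
- by rewrite rmorphD; apply: ID.
- by rewrite rmorphM; apply: IM.
Qed.

Lemma ideal_gen_map (xs : seq A) y :
  ideal_gen (fun z => z \in xs) y -> ideal_gen (fun z => z \in map f xs) (f y).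
Proof.
apply: ideal_gen_min (preim_is_ideal (ideal_gen_is_ideal _)) _ => z xsz.
by apply/ideal_gen_incl/map_f.
Qed.

Lemma prime_ideal_preim (P : B -> Prop) :
  prime_ideal P -> prime_ideal (fun x => P (f x)).
Proof.
move=> [idP P1 prP]; split; first exact: preim_is_ideal.
  by rewrite rmorph1.
by move=> x y; rewrite rmorphM => /prP.
Qed.

End Morphisms.

Section Transfer.
Local Open Scope ring_scope.
Variables (A B : comNzRingType) (f : {rmorphism A -> B}) (g : {rmorphism B -> A}).
Hypotheses (fK : cancel f g) (gK : cancel g f).

Lemma noetherian_transfer : noetherian B -> noetherian A.
Proof.
move=> nB I idI; have [s sP] := nB _ (preim_is_ideal g idI).
exists (map g s) => x; split=> [Ix|].
  by rewrite -(fK x); apply: ideal_gen_map; apply/sP; rewrite fK.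
apply: ideal_gen_min => // _ /mapP[z sz ->]; apply/sP.
exact: ideal_gen_incl.
Qed.

Lemma regular_ring_transfer : regular_ring B -> regular_ring A.
Proof.
move=> rB P prP; have [xs [xsP xsR xsG]] := rB _ (prime_ideal_preim g prP).
exists (map g xs); split.
- by move=> _ /mapP[z xsz ->]; apply: xsP.
- move=> i y; rewrite size_map => lti; rewrite -map_take (nth_map 0) // => Hy.
  have [s [nPs Hs]] : exists s, ~ P (g s) /\
      ideal_gen (fun z => z \in take i xs) (s * f y).
    apply: xsR => //; move: (ideal_gen_map f Hy).
    by rewrite mapK // rmorphM gK.
  by exists (g s); split=> //; rewrite -[y]fK -rmorphM; apply: ideal_gen_map.
- move=> y Py; have [|s [nPs Hs]] := xsG (f y); first by rewrite fK.
  by exists (g s); split=> //; rewrite -[y]fK -rmorphM; apply: ideal_gen_map.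
Qed.

End Transfer.

Section PolyIdeals.
Local Open Scope ring_scope.
Variable R : comNzRingType.

Lemma ideal_gen_polyC (xs : seq R) (p : {poly R}) :
  ideal_gen (fun z => z \in map polyC xs) p <->
  forall j, ideal_gen (fun z => z \in xs) p`_j.
Proof.
split=> [|H].
  apply: (ideal_gen_min (I := fun p : {poly R} =>
            forall j, ideal_gen (fun z => z \in xs) p`_j)).
    have [J0 JD JM] := ideal_gen_is_ideal (fun z => z \in xs).
    split=> [j|q r Hq Hr j|q r Hr j]; first by rewrite coef0.
      by rewrite coefD; apply: JD.
    by rewrite coefM; apply: ideal_sum => // i _; apply: JM.
  move=> _ /mapP[z xsz ->] j; rewrite coefC.
  have [J0 _ _] := ideal_gen_is_ideal (fun z => z \in xs).
  by case: ifP => // _; apply: ideal_gen_incl.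
rewrite -[p]coefK poly_def.
have idJ := ideal_gen_is_ideal (fun z => z \in map polyC xs).
apply: ideal_sum => // i _; rewrite -mul_polyC.
by apply: ideal_mulr => //; apply: (ideal_gen_map (polyC : {rmorphism R -> {poly R}})).
Qed.

Lemma noetherian_poly : noetherian R -> noetherian {poly R}.
Proof.
move=> nR I idI; have [I0 ID IM] := idI.
pose lead d (a : R) := exists f : {poly R}, [/\ I f, (size f <= d.+1)%N & f`_d = a].
have idL d : is_ideal (lead d).
  split.
  - by exists 0; rewrite size_poly0 coef0.
  - move=> a b [f [If sf <-]] [h [Ih sh <-]]; exists (f + h).
    split; [exact: ID | | by rewrite coefD].
    by rewrite (leq_trans (size_polyD _ _)) // geq_max sf.
  - move=> a b [f [If sf <-]]; exists (a *: f).
    split; [by rewrite -mul_polyC; apply: IM | | by rewrite coefZ].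
    exact: leq_trans (size_scale_leq _ _) sf.
have leadS d e a : (d <= e)%N -> lead d a -> lead e a.
  move=> /subnK <-; elim: (e - d)%N => [//|k IHk] /IHk[f [If sf <-]].
  exists (f * 'X); split; [exact: ideal_mulr | | by rewrite coefMX].
  by rewrite (leq_trans (size_polyMleq _ _)) // size_polyX addn2.
have [s sP] : exists s : seq R, ideal_eq (fun a => exists d, lead d a)
                                          (ideal_gen (fun z => z \in s)).
  apply: nR; split.
  - by exists 0%N; case: (idL 0%N).
  - move=> a b [d da] [e eb]; exists (maxn d e); case: (idL (maxn d e)) => _ LD _.
    by apply: LD; [apply: leadS da | apply: leadS eb]; rewrite leq_max leqnn ?orbT.
  - by move=> a b [d da]; exists d; case: (idL d) => _ _ LM; apply: LM.
have [D leadD] : exists D, forall a d, lead d a -> lead D a.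
  suff [D HD] : exists D, forall z, z \in s -> lead D z.
    exists D => a d da; have /sP : exists d, lead d a by exists d.
    exact: ideal_gen_min.
  have: forall z, z \in s -> exists d, lead d z.
    by move=> z sz; apply/sP/ideal_gen_incl.
  elim: s {sP} => [|a s IHs] H; first by exists 0%N.
  have [z sz|D HD] := IHs; first by apply: H; rewrite inE sz orbT.
  have [|d Hd] := H a; first by rewrite inE eqxx.
  exists (maxn D d) => z; rewrite inE => /predU1P[->|/HD].
    by apply: leadS Hd; rewrite leq_maxr.
  by apply: leadS; rewrite leq_maxl.
have /choice[F HF] : forall d, exists t : seq {poly R},
    (forall f, f \in t -> I f /\ (size f <= d.+1)%N) /\
    forall a, lead d a -> ideal_gen (fun z => z \in map (coefp d) t) a.
  move=> d; have [r rP] := nR _ (idL d).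
  have: forall z, z \in r -> lead d z by move=> z rz; apply/rP/ideal_gen_incl.
  suff: (forall z, z \in r -> lead d z) -> exists t : seq {poly R},
      (forall f, f \in t -> I f /\ (size f <= d.+1)%N) /\ map (coefp d) t = r.
    by move=> H /H[t [tI tr]]; exists t; split=> // a /rP; rewrite tr.
  elim: r {rP} => [|a r IHr] H; first by exists [::].
  have [z rz|t [tI <-]] := IHr; first by apply: H; rewrite inE rz orbT.
  have [|f [If sf <-]] := H a; first by rewrite inE eqxx.
  exists (f :: t); split=> // h; rewrite inE => /predU1P[->|] //.
  exact: tI.
exists (flatten [seq F d | d <- iota 0 D.+1]) => p.
set G := flatten _; split; last first.
  apply: ideal_gen_min => // f /flattenP[_ /mapP[d _ ->]].
  by case: (HF d) => H _ /H[].
have [G0 GD GM] := ideal_gen_is_ideal (fun z => z \in G).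
have idG := ideal_gen_is_ideal (fun z => z \in G).
move: {2}(size p) (leqnn (size p)) => n; elim: n p => [|n IHn] p.
  by rewrite leqn0 size_poly_eq0 => /eqP->.
move=> sp Ip; pose e := minn n D.
have le_a : lead e p`_n.
  rewrite /e /minn; case: ifP => _; first by exists p.
  by apply: (leadD _ n); exists p.
have [h [Gh sh he]] : exists h : {poly R},
    [/\ ideal_gen (fun z => z \in G) h, (size h <= e.+1)%N & h`_e = p`_n].
  have [HI] := HF e; move/(_ _ le_a).
  apply: (ideal_gen_min (I := fun a => exists h : {poly R},
    [/\ ideal_gen (fun z => z \in G) h, (size h <= e.+1)%N & h`_e = a])).
    split.
    - by exists 0; rewrite size_poly0 coef0.
    - move=> a b [f [If sf <-]] [h [Ih sh <-]]; exists (f + h).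
      split; [exact: GD | | by rewrite coefD].
      by rewrite (leq_trans (size_polyD _ _)) // geq_max sf.
    - move=> a b [f [If sf <-]]; exists (a *: f).
      split; [by rewrite -mul_polyC; apply: GM | | by rewrite coefZ].
      exact: leq_trans (size_scale_leq _ _) sf.
  move=> _ /mapP[f Ff ->]; exists f; have [If sf] := HI _ Ff.
  split=> //; apply/ideal_gen_incl/flattenP; exists (F e) => //.
  by apply/map_f; rewrite mem_iota ltnS geq_minr.
have Ih : I h.
  apply: ideal_gen_min Gh => // f /flattenP[_ /mapP[d _ ->]].
  by case: (HF d) => H _ /H[].
rewrite -[p](subrK (h * 'X^(n - e))); apply: (GD); last exact: ideal_mulr.
apply: IHn; last by apply: ideal_sub => //; apply: ideal_mulr.
apply/leq_sizeP => j; rewrite leq_eqVlt => /predU1P[<-|lt_nj].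
  by rewrite coefB coefMXn ltnNge leq_subr /= subKn ?geq_minl // he subrr.
rewrite coefB coefMXn nth_default ?(leq_trans sp) // sub0r.
case: ifP => _; rewrite ?oppr0 // nth_default ?oppr0 // (leq_trans sh) //.
by have := geq_minl n D; rewrite -/e; lia.
Qed.

Lemma regular_ring_poly : regular_ring R -> regular_ring {poly R}.
Proof.
move=> regR P prP; have [idP P1 mulP] := prP; have [P0 PD PM] := idP.
pose p a := P a%:P.
have prp : prime_ideal p := prime_ideal_preim (polyC : {rmorphism R -> {poly R}}) prP.
have [xs [xsp xsR xsG]] := regR _ prp.
have [idp p1 mulp] := prp; have [p0 pD pM] := idp.
pose inp (f : {poly R}) := forall j, p f`_j.
have inpP f : inp f -> P f.
  move=> pf; rewrite -[f]coefK poly_def; apply: ideal_sum => // i _.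
  by rewrite -mul_polyC; apply: ideal_mulr => //; apply: pf.
have loc ys (f : {poly R}) :
    (forall j, exists s, ~ p s /\ ideal_gen (fun z => z \in ys) (s * f`_j)) ->
    exists s, ~ p s /\ ideal_gen (fun z => z \in map polyC ys) (s%:P * f).
  move=> H; have idJ := ideal_gen_is_ideal (fun z => z \in ys).
  have [s [nps Hs]] := common_multiplier (n := size f) prp idJ (fun i _ => H i).
  exists s; split=> //; apply/ideal_gen_polyC => j; rewrite coefCM.
  have [lt_j|ge_j] := ltnP j (size f); first exact: Hs.
  by rewrite nth_default // mulr0; case: idJ.
have regC i (y : {poly R}) : (i < size xs)%N ->
    ideal_gen (fun z => z \in map polyC (take i xs)) ((xs`_i)%:P * y) ->
    exists s, ~ p s /\ ideal_gen (fun z => z \in map polyC (take i xs)) (s%:P * y).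
  move=> lti /ideal_gen_polyC H; apply: loc => j; apply: xsR => //.
  by rewrite -coefCM.
have genC y : inp y -> exists s, ~ p s /\
    ideal_gen (fun z => z \in map polyC xs) (s%:P * y).
  by move=> py; apply: loc => j; apply: xsG.
have [allP|/existsNP[f0 /not_implyP[Pf0 nf0]]] := pselect (forall f, P f -> inp f).
  exists (map polyC xs); split.
  - by move=> _ /mapP[z xsz ->]; apply: xsp.
  - move=> i y; rewrite size_map => lti; rewrite -map_take (nth_map 0) //.
    by case/regC=> // s [nps Hs]; exists s%:P.
  - by move=> y /allP/genC[s [nps Hs]]; exists s%:P.
have exf : exists n, `[< exists f, [/\ P f, ~ inp f & size f = n] >].
  by exists (size f0); apply/asboolP; exists f0.
case: (ex_minnP exf) => n /asboolP[f [Pf nf sf]] minf.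
have inp_small g : P g -> (size g < size f)%N -> inp g.
  move=> Pg; rewrite ltnNge => /negP ltg; apply: contrapT => ng; apply: ltg.
  by rewrite sf; apply: minf; apply/asboolP; exists g.
have f_neq0 : f != 0.
  by apply/eqP => f0'; apply: nf => j; rewrite f0' coef0.
have nlc : ~ p (lead_coef f).
  move=> plc; apply: nf; pose h : {poly R} := lead_coef f *: 'X^((size f).-1).
  have ph : inp h by move=> j; rewrite coefZ; apply: ideal_mulr.
  have pfh : inp (f - h).
    apply: inp_small; first by apply: ideal_sub => //; apply: inpP.
    rewrite -(prednK (_ : 0 < size f)%N) ?size_poly_gt0 // ltnS.
    apply/leq_sizeP => j; rewrite leq_eqVlt => /predU1P[<-|ltj].
      by rewrite coefB coefZ coefXn eqxx mulr1 subrr.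
    rewrite coefB coefZ coefXn gtn_eqF // mulr0 subr0 nth_default //.
    exact: leq_trans (leqSpred _) ltj.
  by move=> j; rewrite -(subrK h f) coefD; apply: pD.
have nlcX k : ~ p (lead_coef f ^+ k).
  by elim: k => [|k IHk]; rewrite ?expr0 // exprS; case/mulp.
have regf y : inp (f * y) -> inp y.
  move: {2}(size y) (leqnn (size y)) => k; elim: k y => [|k IHk] y.
    by rewrite leqn0 size_poly_eq0 => /eqP-> _ j; rewrite coef0.
  move=> sy py; pose h : {poly R} := y`_k *: 'X^k.
  have pyk : p y`_k.
    have [sy'|lty] := leqP (size y) k; first by rewrite nth_default.
    have def_sy : size y = k.+1 by apply/eqP; rewrite eqn_leq sy.
    have -> : y`_k = lead_coef y by rewrite /lead_coef def_sy.
    have := py (size f + size y).-2; rewrite -mul_lead_coef => /mulp[] //.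
  have ph : inp h by move=> j; rewrite coefZ; apply: ideal_mulr.
  have pyh : inp (y - h).
    apply: IHk; last first.
      move=> j; rewrite mulrBr coefB; apply: ideal_sub => //.
      by rewrite coefM; apply: ideal_sum => // i _; apply: pM.
    apply/leq_sizeP => j; rewrite leq_eqVlt => /predU1P[<-|ltj].
      by rewrite coefB coefZ coefXn eqxx mulr1 subrr.
    rewrite coefB coefZ coefXn gtn_eqF // mulr0 subr0 nth_default //.
    exact: leq_trans sy _.
  by move=> j; rewrite -(subrK h y) coefD; apply: pD.
exists (rcons (map polyC xs) f); split.
- move=> z; rewrite mem_rcons inE => /predU1P[->//|/mapP[a xsa ->]].
  exact: xsp.
- move=> i y; rewrite size_rcons size_map ltnS leq_eqVlt => /predU1P[->|lti].
    rewrite nth_rcons size_map ltnn eqxx -cats1 take_size_cat ?size_map //.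
    move=> Hfy; have /regf/genC[s [nps Hs]] : inp (f * y).
      move/ideal_gen_polyC: Hfy => Hfy j.
      by apply: ideal_gen_min (Hfy j) => // a /xsp.
    by exists s%:P.
  rewrite nth_rcons size_map lti (nth_map 0) // -cats1 takel_cat ?size_map 1?ltnW //.
  by rewrite -map_take; case/regC=> // s [nps Hs]; exists s%:P.
- move=> y Py; set k := Pdiv.Ring.rscalp y f; set q := Pdiv.Ring.rdivp y f.
  set r := Pdiv.Ring.rmodp y f.
  have eq_y : lead_coef f ^+ k *: y = q * f + r := Pdiv.ComRing.rdivp_eq f y.
  have def_r : r = (lead_coef f ^+ k)%:P * y - q * f.
    by rewrite mul_polyC eq_y addrC addKr.
  have /genC[s [nps Hs]] : inp r.
    apply: inp_small; last by rewrite Pdiv.Ring.ltn_rmodpN0.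
    by rewrite def_r; apply: ideal_sub => //; apply: PM.
  exists (s%:P * (lead_coef f ^+ k)%:P); split.
    by rewrite -polyCM => /mulp[//|/nlcX].
  have -> : s%:P * (lead_coef f ^+ k)%:P * y = s%:P * r + s%:P * q * f.
    by rewrite def_r; ring.
  have [_ GD GM] := ideal_gen_is_ideal (fun z => z \in rcons (map polyC xs) f).
  apply: GD.
    by apply: ideal_gen_mono Hs => z; rewrite mem_rcons inE orbC => ->.
  by apply/GM/ideal_gen_incl; rewrite mem_rcons inE eqxx.
Qed.

End PolyIdeals.

Section MpolyUni.
Local Open Scope ring_scope.
Variables (R : comNzRingType) (n : nat).

Definition muni_inv : {poly {mpoly R[n]}} -> {mpoly R[n.+1]} :=
  horner_eval 'X_ord_max \o @mpwiden n R.

HB.instance Definition _ := GRing.RMorphism.on muni_inv.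

Lemma muniX (m : 'X_{1..n.+1}) : muni ('X_[m] : {mpoly R[n.+1]}) =
  'X_[[multinom (m (widen_ord (leqnSn n) i)) | i < n]] *: 'X^(m ord_max).
Proof. by rewrite muniE msuppX big_seq1 mcoeffX eqxx scale1r. Qed.

Lemma muni_invC (c : {mpoly R[n]}) : muni_inv c%:P = mwiden c.
Proof. by rewrite /muni_inv /= mpwidenC /horner_eval hornerC. Qed.

Lemma muni_invX : muni_inv 'X = 'X_ord_max.
Proof. by rewrite /muni_inv /= mpwidenX /horner_eval hornerX. Qed.

Lemma muniK : cancel (@muni n R) muni_inv.
Proof.
have muni_invZ c (q : {poly {mpoly R[n]}}) : muni_inv (c *: q) = mwiden c * muni_inv q.
  by rewrite -mul_polyC rmorphM /= -muni_invC.
move=> p; rewrite [in RHS](mpolyE p) {1}(mpolyE p).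
rewrite (raddf_sum (@muni n R)) (raddf_sum muni_inv); apply: eq_bigr => m _.
rewrite /= muniZ muniX !muni_invZ rmorphXn /= muni_invX mwidenC mwidenX.
rewrite mul_mpolyC; congr (_ *: _).
rewrite mpolyXn -mpolyXD; congr 'X_[_]; apply/mnmP => i.
rewrite mnmDE mulmnE mnm1E.
have [->|neq] := eqVneq i ord_max; first by rewrite mnmwiden_ordmax mul1n.
have lt_in : (i < n)%N.
  by rewrite ltn_neqAle -ltnS ltn_ord andbT; move: neq; rewrite -val_eqE.
have -> : i = widen_ord (leqnSn n) (Ordinal lt_in) by apply: val_inj.
by rewrite mnmwiden_widen mnmE mul0n addn0.
Qed.

Lemma muni_invK : cancel muni_inv (@muni n R).
Proof.
have muniw (c : {mpoly R[n]}) : muni (mwiden c) = c%:P.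
  rewrite [in RHS](mpolyE c) {1}(mpolyE c) (raddf_sum (@mwiden n R)).
  rewrite (raddf_sum (@muni n R)) (raddf_sum polyC).
  apply: eq_bigr => m _.
  rewrite /= mwidenZ muniZ mwidenX muniX mnmwiden_ordmax expr0.
  rewrite -mul_mpolyC polyCM -mul_polyC; congr (_ * _).
  rewrite -mul_polyC mulr1; congr ('X_[_])%:P; apply/mnmP => i.
  by rewrite mnmE mnmwiden_widen.
move=> p; rewrite -[p]coefK poly_def (raddf_sum muni_inv) (raddf_sum (@muni n R)).
apply: eq_bigr => i _; rewrite /= -mul_polyC.
rewrite !(rmorphM, rmorphXn, rmorphM (@muni n R), rmorphXn (@muni n R)) /=.
rewrite muni_invC muniw muni_invX; congr (_ * _ ^+ _).
rewrite muniX mnm1E eqxx expr1.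
set m := [multinom _ | _ < _]; have -> : m = 0%MM.
  apply/mnmP => j; rewrite mnmE mnm0E mnm1E -val_eqE /= gtn_eqF //.
by rewrite mpolyX0 scale1r.
Qed.

Let muniR : {rmorphism {mpoly R[n.+1]} -> {poly {mpoly R[n]}}} := @muni n R.
Let muni_invR : {rmorphism {poly {mpoly R[n]}} -> {mpoly R[n.+1]}} := muni_inv.

Lemma noetherian_mpolyS : noetherian {mpoly R[n]} -> noetherian {mpoly R[n.+1]}.
Proof.
by move/noetherian_poly; apply: (@noetherian_transfer _ _ muniR muni_invR muniK).
Qed.

Lemma regular_ring_mpolyS : regular_ring {mpoly R[n]} -> regular_ring {mpoly R[n.+1]}.
Proof.
move/regular_ring_poly.
exact: (@regular_ring_transfer _ _ muniR muni_invR muniK muni_invK).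
Qed.

End MpolyUni.

Section MpolyRegular.
Local Open Scope ring_scope.
Variable K : fieldType.

Lemma mpoly0_const (p : {mpoly K[0]}) : p = (p@_0)%:MP.
Proof.
apply/mpolyP => m; rewrite mcoeffC.
have -> : m = 0%MM by apply/mnmP; case.
by rewrite eqxx mulr1.
Qed.

Lemma mpoly0_ideal (I : {mpoly K[0]} -> Prop) (x : {mpoly K[0]}) :
  is_ideal I -> I x -> x != 0 -> I 1.
Proof.
move=> [_ _ IM] Ix; rewrite (mpoly0_const x) mpolyC_eq0 => x0.
rewrite -(mpolyC1 0 K) -(mulVf x0) mpolyCM -mpoly0_const; exact: IM.
Qed.

Lemma noetherian_mpoly (n : nat) : noetherian {mpoly K[n]}.
Proof.
elim: n => [|n IHn]; last first.
  exact: (noetherian_mpolyS (R := K) IHn).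
move=> I idI; have [I0 _ IM] := idI.
have [I1|nI1] := pselect (I 1).
  exists [:: 1] => p; split=> _; last by rewrite -[p]mulr1; apply: IM.
  have [_ _ GM] := ideal_gen_is_ideal (fun z : {mpoly K[0]} => z \in [:: 1]).
  by rewrite -[p]mulr1; apply/GM/ideal_gen_incl; rewrite inE.
exists [::] => p; split=> [Ip|]; last exact: ideal_gen_min.
have [->|/(mpoly0_ideal idI Ip)//] := eqVneq p 0.
by case: (ideal_gen_is_ideal (fun z : {mpoly K[0]} => z \in [::])).
Qed.

Lemma regular_ring_mpoly (n : nat) : regular_ring {mpoly K[n]}.
Proof.
elim: n => [|n IHn]; last first.
  exact: (regular_ring_mpolyS (R := K) IHn).
move=> P [idP P1 _]; exists [::]; split=> // y Py.
have [->|/(mpoly0_ideal idP Py)//] := eqVneq y 0.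
exists 1; split=> //; rewrite mulr0.
by case: (ideal_gen_is_ideal (fun z : {mpoly K[0]} => z \in [::])).
Qed.

End MpolyRegular.

Section RegularGorenstein.
Local Open Scope ring_scope.
Variables (R L : comNzRingType) (P : R -> Prop) (phi : {rmorphism R -> L}).
Hypotheses (prP : prime_ideal P) (locL : is_localization P phi).

Lemma localization_cancel (I : L -> Prop) s x :
  is_ideal I -> ~ P s -> I (x * phi s) -> I x.
Proof.
move=> idI nPs Ix; have [Lu _ _] := locL; have [u us] := Lu _ nPs.
by rewrite -[x]mulr1 -us mulrA; apply: ideal_mulr.
Qed.

Lemma localization_ideal (xs : seq R) (a : R) :
  ideal_gen (fun z => z \in map phi xs) (phi a) <->
  exists s, ~ P s /\ ideal_gen (fun z => z \in xs) (s * a).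
Proof.
have [idP P1 mulP] := prP; have [Lu Lf Lk] := locL.
split=> [H|[s [nPs Hs]]]; last first.
  apply: (localization_cancel (ideal_gen_is_ideal _) nPs).
  by rewrite mulrC -rmorphM; apply: ideal_gen_map.
have [t [b [nPt Gb eqb]]] : exists t b, [/\ ~ P t,
    ideal_gen (fun z => z \in xs) b & phi a * phi t = phi b].
  apply: (ideal_gen_min (I := fun y => exists t b, [/\ ~ P t,
    ideal_gen (fun z => z \in xs) b & y * phi t = phi b])) H.
    have [G0 GD GM] := ideal_gen_is_ideal (fun z => z \in xs).
    split.
    - by exists 1, 0; rewrite rmorph0 mul0r.
    - move=> x y [s [b [nPs Gb xs_b]]] [t [c [nPt Gc yt_c]]].
      exists (s * t), (t * b + s * c); split; first by case/mulP.
        by apply: GD; apply: GM.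
      by rewrite rmorphD !rmorphM -xs_b -yt_c; ring.
    - move=> z x [s [b [nPs Gb xs_b]]]; have [c [t [nPt zt_c]]] := Lf z.
      exists (t * s), (c * b); split; [by case/mulP | exact: GM |].
      by rewrite !rmorphM -xs_b -zt_c; ring.
  move=> _ /mapP[z xsz ->]; exists 1, z; split=> //; last by rewrite rmorph1 mulr1.
  exact: ideal_gen_incl.
have [|s [nPs Hs]] := Lk (a * t - b).
  by rewrite rmorphB rmorphM eqb subrr.
exists (s * t); split; first by case/mulP.
have -> : s * t * a = s * (a * t - b) + s * b by ring.
rewrite Hs add0r.
by have [_ _ GM] := ideal_gen_is_ideal (fun z => z \in xs); apply: GM.
Qed.

Lemma localization_nonunit x : nonunit x ->
  exists a s, [/\ P a, ~ P s & x * phi s = phi a].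
Proof.
have [Lu Lf _] := locL; move=> nx; have [a [s [nPs xs_a]]] := Lf x.
exists a, s; split=> //; apply: contrapT => /Lu[u au]; apply: nx.
by exists (phi s * u); rewrite mulrA xs_a.
Qed.

(* The maximal ideal itself is generated by a regular sequence, so that the
   quotient is the residue field, which is its own socle. *)
Lemma regular_gorenstein_local (xs : seq R) :
  regular_params P xs -> gorenstein_local L.
Proof.
have [idP P1 mulP] := prP; have [Lu Lf Lk] := locL.
move=> [xsP xsR xsG]; exists (map phi xs).
have subP a s : ideal_gen (fun z => z \in xs) (s * a) -> ~ P s -> P a.
  move=> Gsa nPs; have /mulP[] // : P (s * a).
  by apply: ideal_gen_min Gsa => // z /xsP.
have n1 : ~ ideal_gen (fun z => z \in map phi xs) 1.
  rewrite -(rmorph1 phi) => /localization_ideal[s [nPs]].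
  by move=> /subP/(_ nPs).
have genJ y : nonunit y -> ideal_gen (fun z => z \in map phi xs) y.
  move=> /localization_nonunit[a [s [Pa nPs ys_a]]].
  apply: (localization_cancel (ideal_gen_is_ideal _) nPs); rewrite ys_a.
  exact/localization_ideal/xsG.
have idJ := ideal_gen_is_ideal (fun z => z \in map phi xs).
split.
- move=> _ /mapP[x xsx ->] [y xy1].
  apply: n1; rewrite -xy1; apply: ideal_mulr => //.
  exact/ideal_gen_incl/map_f.
- split=> // i y; rewrite size_map => lti; rewrite (nth_map 0) // -map_take => Gy.
  have [a [s [nPs ys_a]]] := Lf y.
  have /localization_ideal[t [nPt]] :
      ideal_gen (fun z => z \in map phi (take i xs)) (phi (xs`_i * a)).
    by rewrite rmorphM -ys_a mulrA; apply: ideal_mulr => //; apply: ideal_gen_is_ideal.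
  rewrite mulrCA => /xsR-/(_ lti)[u [nPu]]; rewrite mulrA => Gua.
  apply: (localization_cancel (ideal_gen_is_ideal _) nPs); rewrite ys_a.
  by apply/localization_ideal; exists (u * t); split=> //; case/mulP.
- exists 1%N => y; apply: ideal_gen_min => // _ [x [nx ->]].
  by rewrite big_ord1; apply: genJ.
- exists 1; split=> // [a /genJ|v _]; first by rewrite mulr1.
  exists v; rewrite mulr1 subrr; by case: idJ.
Qed.

End RegularGorenstein.

Lemma regular_gorenstein (R : comNzRingType) :
  noetherian R -> regular_ring R -> gorenstein R.
Proof.
move=> nR rR; split=> // P maxP L phi locL.
have prP := maximal_ideal_prime maxP; have [xs Hxs] := rR P prP.
exact: (regular_gorenstein_local prP locL Hxs).
Qed.


Lemma gorenstein_alg_iso_mpoly (K : fieldType) (A : comAlgType K) (v : nat) :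
  alg_iso A {mpoly K[v]} -> gorenstein A.
Proof.
case=> f [g fK gK].
pose fR : {rmorphism A -> {mpoly K[v]}} := f.
have gA := can2_zmod_morphism fK gK.
have gM := can2_monoid_morphism fK gK.
pose gR := HB.pack_for {rmorphism {mpoly K[v]} -> A} g
  (GRing.isZmodMorphism.Build _ _ g gA) (GRing.isMonoidMorphism.Build _ _ g gM).
apply: regular_gorenstein.
  exact: (@noetherian_transfer _ _ fR gR fK (@noetherian_mpoly K v)).
exact: (@regular_ring_transfer _ _ fR gR fK gK (@regular_ring_mpoly K v)).
Qed.

(** * Toric rings *)

Section MonomialSpan.
Local Open Scope ring_scope.
Variables (K : fieldType) (n r : nat) (h : 'X_{1..n} -> 'X_{1..r}).

Definition mon_lin (p : {mpoly K[n]}) : {mpoly K[r]} :=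
  \sum_(m <- msupp p) p@_m *: 'X_[h m].

Lemma mon_linE k p : (msize p <= k)%N ->
  mon_lin p = \sum_(m : 'X_{1..n < k}) p@_m *: 'X_[h m].
Proof.
move=> le_pk; pose I : subFinType _ := 'X_{1..n < k}.
rewrite /mon_lin (big_mksub I) ?msupp_uniq //=; first last.
  by move=> x /msize_mdeg_lt /leq_trans; apply.
by rewrite big_rmcond //= => j /memN_msupp_eq0 ->; rewrite scale0r.
Qed.

Lemma mon_lin_is_linear : linear mon_lin.
Proof.
move=> a p q; pose k := (msize p + msize q + msize (a *: p + q)%R)%N.
rewrite !(mon_linE (k := k)) ?leq_addl //; last 2 first.
- by rewrite /k addnAC leq_addl.
- by rewrite /k -addnA leq_addr.
rewrite scaler_sumr -big_split; apply: eq_bigr => m _ /=.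
by rewrite mcoeffD mcoeffZ scalerDl scalerA.
Qed.

HB.instance Definition _ :=
  GRing.isLinear.Build K {mpoly K[n]} {mpoly K[r]} _ mon_lin mon_lin_is_linear.

Lemma mon_linX m : mon_lin 'X_[m] = 'X_[h m].
Proof. by rewrite /mon_lin msuppX big_seq1 mcoeffX eqxx scale1r. Qed.

Lemma msupp_mon_lin p m :
  m \in msupp (mon_lin p) -> exists2 m', m' \in msupp p & m = h m'.
Proof.
move=> /msupp_sum_le/flattenP[_ /mapP[m' + ->]]; rewrite mem_filter /= => pm'.
by move=> /msuppZ_le; rewrite msuppX inE => /eqP->; exists m'.
Qed.

Lemma mon_lin_mul (p q : {mpoly K[n]}) :
  (forall m m', m \in msupp p -> m' \in msupp q -> h (m + m') = (h m + h m')%MM) ->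
  mon_lin (p * q) = mon_lin p * mon_lin q.
Proof.
move=> hD; rewrite [in LHS](mpolyE p) [in LHS](mpolyE q) big_distrlr /= raddf_sum /=.
rewrite [mon_lin p]/mon_lin [mon_lin q]/mon_lin [RHS]big_distrlr /=.
rewrite big_seq [RHS]big_seq; apply: eq_bigr => m pm.
rewrite raddf_sum big_seq [RHS]big_seq; apply: eq_bigr => m' qm' /=.
rewrite -scalerAl -scalerAr scalerA linearZ /= -mpolyXD mon_linX hD //.
by rewrite -scalerAl -scalerAr scalerA mpolyXD.
Qed.

End MonomialSpan.

Lemma mon_linK (K : fieldType) (n r : nat) (h : 'X_{1..n} -> 'X_{1..r})
    (h' : 'X_{1..r} -> 'X_{1..n}) (p : {mpoly K[n]}) :
  (forall m, m \in msupp p -> h' (h m) = m) -> mon_lin h' (mon_lin h p) = p.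
Proof.
move=> hK; rewrite [mon_lin h p]/mon_lin raddf_sum /= [RHS]mpolyE.
rewrite big_seq [RHS]big_seq; apply: eq_bigr => m pm.
by rewrite linearZ /= mon_linX hK.
Qed.

Section ToricSpan.
Local Open Scope ring_scope.
Variables (K : fieldType) (n : nat) (W : 'X_{1..n} -> Prop).

Definition mon_monoid (m : 'X_{1..n}) : Prop :=
  exists2 s : seq 'X_{1..n}, (forall w, w \in s -> W w) & m = (\sum_(w <- s) w)%MM.

Lemma mon_monoid0 : mon_monoid 0%MM.
Proof. by exists [::]; rewrite ?big_nil. Qed.

Lemma mon_monoidD m m' : mon_monoid m -> mon_monoid m' -> mon_monoid (m + m')%MM.
Proof.
move=> [s sW ->] [t tW ->]; exists (s ++ t); last by rewrite big_cat.
by move=> w; rewrite mem_cat => /orP[/sW|/tW].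
Qed.

Lemma mon_monoid1 w : W w -> mon_monoid w.
Proof.
by move=> Ww; exists [:: w]; rewrite ?big_seq1 // => u; rewrite inE => /eqP->.
Qed.

Lemma toric_predP (p : {mpoly K[n]}) :
  reflect (forall m, m \in msupp p -> mon_monoid m) (p \in toric_pred W).
Proof.
apply: (iffP (asboolP _)) => [pW|pW A [A1 AD AM] WA].
  pose A : {pred {mpoly K[n]}} := fun p =>
    `[< forall m, m \in msupp p -> mon_monoid m >].
  suff /asboolP : p \in A by [].
  apply: pW => [|w Ww]; last first.
    by apply/asboolP => m; rewrite msuppX inE => /eqP->; apply: mon_monoid1.
  split.
  - by apply/asboolP => m; rewrite msupp1 inE => /eqP->; apply: mon_monoid0.
  - move=> a u v /asboolP Au /asboolP Av; apply/asboolP => m.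
    by move=> /msuppD_le; rewrite mem_cat => /orP[/msuppZ_le/Au|/Av].
  - move=> u v /asboolP Au /asboolP Av; apply/asboolP => m.
    by move=> /msuppM_le/allpairsP[[m1 m2] /= [/Au ? /Av ? ->]]; apply: mon_monoidD.
have A0 : 0 \in A by rewrite -[0](addNr 1) -scaleN1r; apply: AD.
have AX m : mon_monoid m -> 'X_[m] \in A.
  move=> [s sW ->]; elim: s sW => [|w s IHs] sW; first by rewrite big_nil mpolyX0.
  rewrite big_cons mpolyXD; apply: AM; first by apply/WA/sW; rewrite inE eqxx.
  by apply: IHs => u su; apply: sW; rewrite inE su orbT.
rewrite [p]mpolyE big_seq; apply: (big_ind (fun x => x \in A)).
- by [].
- by move=> x y Ax Ay; rewrite -[x]scale1r; apply: AD.
move=> m /pW pm.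
by rewrite -[X in X \in _]addr0; apply: AD => //; apply: AX.
Qed.

Lemma msupp_toric (x : toric K W) m : m \in msupp (val x) -> mon_monoid m.
Proof. exact/toric_predP/(valP x). Qed.

End ToricSpan.

Section ToricMap.
Local Open Scope ring_scope.
Variables (K : fieldType) (n r : nat).
Variables (W : 'X_{1..n} -> Prop) (W' : 'X_{1..r} -> Prop) (h : 'X_{1..n} -> 'X_{1..r}).
Hypotheses (h0 : h 0 = 0%MM)
  (hW : forall m, mon_monoid W m -> mon_monoid W' (h m))
  (hD : forall m m', mon_monoid W m -> mon_monoid W m' -> h (m + m') = (h m + h m')%MM).

Lemma toric_map_subproof (x : toric K W) : mon_lin h (val x) \in toric_pred W'.
Proof.
apply/toric_predP => m /msupp_mon_lin[m' xm' ->].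
by apply/hW/(msupp_toric xm').
Qed.

Definition toric_map (x : toric K W) : toric K W' := Toric (toric_map_subproof x).

Lemma toric_map_linear : linear toric_map.
Proof. by move=> a x y; apply: val_inj; rewrite /= linearP. Qed.

Lemma toric_map_monoid : monoid_morphism toric_map.
Proof.
split=> [|x y]; apply: val_inj => /=; first by rewrite -mpolyX0 mon_linX h0 mpolyX0.
by apply: mon_lin_mul => m m' /msupp_toric Wm /msupp_toric Wm'; apply: hD.
Qed.

End ToricMap.

Lemma toric_alg_iso (K : fieldType) (n r : nat) (W : 'X_{1..n} -> Prop)
    (W' : 'X_{1..r} -> Prop)
    (h : 'X_{1..n} -> 'X_{1..r}) (h' : 'X_{1..r} -> 'X_{1..n}) :
  (forall m, mon_monoid W m -> mon_monoid W' (h m) /\ h' (h m) = m) ->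
  (forall m, mon_monoid W' m -> mon_monoid W (h' m) /\ h (h' m) = m) ->
  h 0%MM = 0%MM ->
  (forall m m', mon_monoid W m -> mon_monoid W m' -> h (m + m')%MM = (h m + h m')%MM) ->
  alg_iso (toric K W) (toric K W').
Proof.
move=> hW hW' h0 hD.
have hW1 m Wm := (hW m Wm).1; have hW'1 m W'm := (hW' m W'm).1.
pose f := @toric_map K _ _ _ _ _ hW1; pose g := @toric_map K _ _ _ _ _ hW'1.
have fL : linear f by apply: toric_map_linear.
have fM : monoid_morphism f by apply: toric_map_monoid.
pose fR := HB.pack_for {lrmorphism toric K W -> toric K W'} f
  (GRing.isLinear.Build _ _ _ _ f fL) (GRing.isMonoidMorphism.Build _ _ f fM).
exists fR; exists g => x; apply: val_inj; apply: mon_linK => m.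
  by move=> /msupp_toric/hW[].
by move=> /msupp_toric/hW'[].
Qed.

(* It suffices to give a surjection [phi] between the generating sets which
   matches all the additive relations on both sides. *)
Lemma toric_alg_iso_gens (K : fieldType) (n r : nat) (W : 'X_{1..n} -> Prop)
    (W' : 'X_{1..r} -> Prop) (phi h : 'X_{1..n} -> 'X_{1..r})
    (h' : 'X_{1..r} -> 'X_{1..n}) :
  (forall w, W w -> W' (phi w)) ->
  (forall w', W' w' -> exists2 w, W w & w' = phi w) ->
  (forall s : seq 'X_{1..n}, (forall w, w \in s -> W w) ->
     h (\sum_(w <- s) w)%MM = (\sum_(w <- s) phi w)%MM /\
     h' (\sum_(w <- s) phi w)%MM = (\sum_(w <- s) w)%MM) ->
  alg_iso (toric K W) (toric K W').
Proof.
move=> phiW phiW' hs.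
have map_phi s : (forall w', w' \in s -> W' w') ->
    exists2 t, (forall w, w \in t -> W w) & s = map phi t.
  elim: s => [|w' s IHs] H; first by exists [::].
  have [u su|t tW ->] := IHs; first by apply: H; rewrite inE su orbT.
  have [|w Ww ->] := phiW' w'; first by apply: H; rewrite inE eqxx.
  by exists (w :: t) => // u; rewrite inE => /predU1P[->//|/tW].
apply: (@toric_alg_iso K n r W W' h h').
- move=> _ [s sW ->]; have [-> ->] := hs s sW; split=> //.
  exists (map phi s); last by rewrite big_map.
  by move=> _ /mapP[w /sW/phiW + ->].
- move=> _ [_ /map_phi[s sW ->] ->]; rewrite big_map; have [h_s ->] := hs s sW.
  by split=> //; exists s.
- by have [//|] := hs [::]; rewrite !big_nil.
- move=> _ _ [s sW ->] [t tW ->]; rewrite -big_cat.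
  rewrite (hs _ sW).1 (hs _ tW).1 (hs (s ++ t) _).1 ?big_cat // => w.
  by rewrite mem_cat => /orP[/sW|/tW].
Qed.

Section ToricPolynomial.
Local Open Scope ring_scope.
Variables (K : fieldType) (v : nat).

Lemma toric_vars_full (p : {mpoly K[v]}) :
  p \in toric_pred (fun w : 'X_{1..v} => exists i, w = U_(i)%MM).
Proof.
apply/toric_predP => m _.
have -> : m = (\sum_(i < v) U_(i) *+ m i)%MM.
  apply/mnmP => i; rewrite mnm_sumE (bigD1 i) //= mulmnE mnm1E eqxx mul1n.
  by rewrite big1 ?addn0 // => j ne; rewrite mulmnE mnm1E (negbTE ne).
apply: big_ind => [|x y|i _]; [exact: mon_monoid0 | exact: mon_monoidD |].
elim: (m i) => [|k IHk]; first exact: mon_monoid0.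
by rewrite mulmS; apply: mon_monoidD => //; apply: mon_monoid1; exists i.
Qed.

Lemma toric_vars_alg_iso :
  alg_iso (toric K (fun w : 'X_{1..v} => exists i, w = U_(i)%MM)) {mpoly K[v]}.
Proof.
set T := toric _ _; pose f (x : T) : {mpoly K[v]} := val x.
have fL : linear f by move=> a x y; rewrite /f linearP.
have fM : monoid_morphism f by split=> [|x y]; rewrite /f ?rmorph1 ?rmorphM.
pose fR := HB.pack_for {lrmorphism T -> {mpoly K[v]}} f
  (GRing.isLinear.Build _ _ _ _ f fL) (GRing.isMonoidMorphism.Build _ _ f fM).
exists fR; exists (fun p => Toric (toric_vars_full p)) => x //.
exact: val_inj.
Qed.

End ToricPolynomial.

Lemma alg_iso_trans (K : fieldType) (A B C : algType K) :
  alg_iso A B -> alg_iso B C -> alg_iso A C.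
Proof.
move=> [f bf] [g bg].
exists (g \o f : {lrmorphism A -> C}); exact: bij_comp.
Qed.

(** * Sums of edges *)

Section EdgeSums.
Variables (n : nat) (E : {set {set 'I_n}}).
Implicit Types a b c w m : 'X_{1..n}.

Fixpoint edge_sum (q : nat) a : Prop :=
  if q is q'.+1 then exists k l b,
    [/\ [set k; l] \in E, edge_sum q' b & a = (U_(k) + U_(l) + b)%MM]
  else a = 0%MM.

Lemma mdeg_edge_sum q a : edge_sum q a -> mdeg a = q.*2.
Proof.
elim: q a => [|q IHq] a /=; first by move=> ->; rewrite mdeg0.
by move=> [k [l [b [_ /IHq Eb ->]]]]; rewrite !mdegD !mdeg1 Eb.
Qed.

Local Open Scope ring_scope.
Variable K : fieldType.
Implicit Types p : {mpoly K[n]}.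

Definition dominated (W : 'X_{1..n} -> Prop) p : Prop :=
  forall m, m \in msupp p -> exists2 w, W w & (w <= m)%MM.

Lemma dominated_is_ideal W : is_ideal (dominated W).
Proof.
split=> [m|p q Wp Wq m|p q Wq m]; first by rewrite msupp0.
  by move=> /msuppD_le; rewrite mem_cat => /orP[/Wp|/Wq].
move=> /msuppM_le/allpairsP[[m1 m2] /= [_ /Wq[w Ww le_w] ->]].
by exists w => //; apply: lepm_trans le_w (lem_addl _ _).
Qed.

Lemma dominatedX W m : W m -> dominated W 'X_[m].
Proof. by move=> Wm m'; rewrite msuppX inE => /eqP->; exists m; rewrite ?lepm_refl. Qed.

Lemma ideal_gen_dominated (W : 'X_{1..n} -> Prop) p :
  ideal_gen (fun p => exists2 w, W w & p = 'X_[w]) p -> dominated W p.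
Proof.
apply: ideal_gen_min (dominated_is_ideal W) _ => _ [w Ww ->].
exact: dominatedX.
Qed.

Lemma edge_ideal_dominated p : edge_ideal E p -> dominated (edge_sum 1) p.
Proof.
apply: ideal_gen_min (dominated_is_ideal _) _ => _ [k [l [Ekl ->]]].
rewrite -mpolyXD; apply: dominatedX.
by exists k, l, 0%MM; rewrite addm0.
Qed.

Lemma ideal_pow_dominated q p :
  ideal_pow (edge_ideal E) q p -> dominated (edge_sum q) p.
Proof.
apply: ideal_gen_min (dominated_is_ideal _) _ => _ [x [Ex ->]].
elim: q x Ex => [|q IHq] x Ex.
  by rewrite big_ord0 -mpolyX0; apply: dominatedX.
rewrite big_ord_recl => _ /msuppM_le/allpairsP[[m1 m2] /= [xm1 xm2 ->]].
have [_ [k [l [_ [Ekl -> ->]]]] le1] := edge_ideal_dominated (Ex ord0) xm1.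
have [w Ew le2] := IHq _ (fun i => Ex (lift ord0 i)) _ xm2.
exists (U_(k) + U_(l) + w)%MM; first by exists k, l, w.
rewrite addm0 in le1; apply/mnm_lepP => i; rewrite (mnmDE i _ w) (mnmDE i m1).
by apply: leq_add; [apply: (mnm_lepP le1) | apply: (mnm_lepP le2)].
Qed.

Lemma edge_sum_ideal_pow q w : edge_sum q w -> ideal_pow (@edge_ideal K n E) q 'X_[w].
Proof.
move=> Ew; apply: ideal_gen_incl; elim: q w Ew => [|q IHq] w /=.
  by move=> ->; exists (fun=> 0); split; [case | rewrite big_ord0 mpolyX0].
move=> [k [l [b [Ekl /IHq[x [Ex def_b]] ->]]]].
exists (fun i => if unlift ord0 i is Some j then x j else 'X_k * 'X_l); split.
  move=> i; case: unliftP => [j|] _ //.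
  by apply: ideal_gen_incl; exists k, l.
rewrite big_ord_recl unlift_none !mpolyXD def_b; congr (_ * _).
by apply: eq_bigr => i _; rewrite liftK.
Qed.

Definition bounded_edge_sum c q w : Prop := edge_sum q w /\ (w <= c)%MM.

Lemma bounded_pow_gens c q :
  monomial_gens (bounded_pow c (@edge_ideal K n E) q) (bounded_edge_sum c q).
Proof.
move=> p; split.
  apply: ideal_gen_min; first exact: ideal_gen_is_ideal.
  move=> _ [a [/ideal_pow_dominated Ja le_ac ->]].
  have [|w Ew le_wa] := Ja a; first by rewrite msuppX inE.
  rewrite -(submK le_wa) mpolyXD.
  have [_ _ GM] := ideal_gen_is_ideal
    (fun p : {mpoly K[n]} => exists2 w, bounded_edge_sum c q w & p = 'X_[w]).
  apply/GM/ideal_gen_incl; exists w => //; split=> //.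
  exact: lepm_trans le_wa le_ac.
apply: ideal_gen_mono => _ [w [Ew le_wc] ->]; exists w; split=> //.
exact: edge_sum_ideal_pow.
Qed.

Lemma bounded_pow_nonzero c q :
  ideal_nonzero (bounded_pow c (@edge_ideal K n E) q) <->
  exists w, bounded_edge_sum c q w.
Proof.
split=> [[p [/bounded_pow_gens/ideal_gen_dominated Wp p0]]|[w Ww]].
  have [w Ww _] : exists2 w, bounded_edge_sum c q w & (w <= mlead p)%MM.
    exact/Wp/mlead_supp.
  by exists w.
exists 'X_[w]; split; last by rewrite -msupp_eq0 msuppX.
by apply/bounded_pow_gens/ideal_gen_incl; exists w.
Qed.

Lemma bounded_pow_maxE c q :
  (exists w, bounded_edge_sum c q w) ->
  (forall q' w, bounded_edge_sum c q' w -> (q' <= q)%N) ->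
  bounded_pow_max c (@edge_ideal K n E) = q.
Proof.
move=> /bounded_pow_nonzero Wq maxq; apply: classical_sets.xget_subset1 => /=.
  by split=> // q' /bounded_pow_nonzero[w /maxq].
move=> q1 q2 [W1 max1] [W2 max2]; apply/eqP; rewrite eqn_leq.
by rewrite max1 // max2.
Qed.

Lemma monomial_gens_sub_homog (J : {mpoly K[n]} -> Prop) d
    (W W' : 'X_{1..n} -> Prop) :
  (forall w, W w -> mdeg w = d) -> monomial_gens J W -> monomial_gens J W' ->
  forall w, W w -> W' w.
Proof.
move=> degW JW JW' w Ww.
have memX (V : 'X_{1..n} -> Prop) v : monomial_gens J V -> V v -> J 'X_[v].
  by move=> JV Vv; apply/JV/ideal_gen_incl; exists v.
have domX (V : 'X_{1..n} -> Prop) v : monomial_gens J V -> J 'X_[v] ->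
    exists2 w, V w & (w <= v)%MM.
  by move=> JV /JV/ideal_gen_dominated/(_ v); rewrite msuppX inE eqxx; apply.
have [w' W'w' le_w'w] := domX _ _ JW' (memX _ _ JW Ww).
have [u Wu le_uw'] := domX _ _ JW (memX _ _ JW' W'w').
suff eq_uw : u = w.
  have -> // : w = w'; apply/mnmP => i; apply/eqP; rewrite eqn_leq.
  by rewrite -{1}eq_uw (mnm_lepP le_uw') (mnm_lepP le_w'w).
have le_uw : (u <= w)%MM := lepm_trans le_uw' le_w'w.
rewrite -[RHS](submK le_uw); suff /eqP-> : (w - u)%MM == 0%MM by rewrite add0m.
rewrite -mdeg_eq0 -(eqn_add2r (mdeg u)) -mdegD submK //.
by rewrite (degW _ Ww) (degW _ Wu).
Qed.

Lemma minimal_gensE (J : {mpoly K[n]} -> Prop) d (W : 'X_{1..n} -> Prop) :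
  (forall w, W w -> mdeg w = d) -> monomial_gens J W -> minimal_gens J = W.
Proof.
move=> degW JW; apply: classical_sets.xget_subset1 => /=.
  by split=> // W' _ JW' w; apply: monomial_gens_sub_homog degW JW JW' _.
suff minW V : (monomial_gens J V /\ forall W', (forall w, W' w -> V w) ->
    monomial_gens J W' -> forall w, V w -> W' w) -> V = W.
  by move=> V V' /minW-> /minW->.
move=> [JV minV]; have WV := monomial_gens_sub_homog degW JW JV.
by apply/funext => w; apply/propext; split; [apply: minV | apply: WV].
Qed.

Lemma bounded_toricE c q :
  (exists w, bounded_edge_sum c q w) ->
  (forall q' w, bounded_edge_sum c q' w -> (q' <= q)%N) ->
  bounded_toric K c E = toric K (bounded_edge_sum c q).
Proof.
move=> exW maxq; rewrite /bounded_toric (bounded_pow_maxE exW maxq).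
congr toric; apply: (minimal_gensE (d := q.*2)); last exact: bounded_pow_gens.
by move=> w [/mdeg_edge_sum].
Qed.

End EdgeSums.

Section Weights.
Variable n : nat.
Implicit Types (a b c w : 'X_{1..n}) (S : {set 'I_n}) (E : {set {set 'I_n}}).

Definition weight a S : nat := \sum_(i in S) a i.

Lemma weightD a b S : weight (a + b)%MM S = weight a S + weight b S.
Proof. by rewrite /weight -big_split; apply: eq_bigr => i _; rewrite mnmDE. Qed.

Lemma weight1 k S : weight U_(k)%MM S = (k \in S).
Proof.
rewrite /weight (eq_bigr (fun i => (k == i) : nat)) => [|i _]; last by rewrite mnm1E.
case: (boolP (k \in S)) => Sk.
  by rewrite (bigD1 k) //= eqxx big1 // => i /andP[_ ne]; rewrite eq_sym (negbTE ne).
rewrite big1 // => i Si; case: eqP => // eq_ki.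
by rewrite eq_ki Si in Sk.
Qed.

Lemma weight_set1 a k : weight a [set k] = a k.
Proof. exact: big_set1. Qed.

Lemma weight_set2 a k l : k != l -> weight a [set k; l] = a k + a l.
Proof. by move=> ne; rewrite /weight big_setU1 ?big_set1 // inE. Qed.

Lemma weightC a S : weight a S + weight a (~: S) = mdeg a.
Proof.
rewrite mdegE (bigID (mem S)) /=; congr (_ + _).
by apply: eq_bigl => i; rewrite inE.
Qed.

Lemma weight_sub a S1 S2 : S1 \subset S2 -> weight a S1 <= weight a S2.
Proof.
move=> sub; rewrite /weight [leqRHS](big_setID S1) /= (setIidPr sub).
exact: leq_addr.
Qed.

Lemma weightU a S1 S2 : [disjoint S1 & S2] ->
  weight a (S1 :|: S2) = weight a S1 + weight a S2.
Proof.
by move=> dis; rewrite /weight -bigU //=; apply: eq_bigl => i; rewrite !inE.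
Qed.

Lemma weightD1 a S k : k \in S -> weight a S = a k + weight a (S :\ k).
Proof. exact: big_setD1. Qed.

Lemma weight_le a b S : (forall i, i \in S -> a i <= b i) -> weight a S <= weight b S.
Proof. exact: leq_sum. Qed.

Lemma eq_weight a b S : (forall i, i \in S -> a i = b i) -> weight a S = weight b S.
Proof. exact: eq_bigr. Qed.

Lemma weight_gt0 a S : 0 < weight a S -> exists2 i, i \in S & 0 < a i.
Proof.
move=> pos; case: (pickP [pred i in S | 0 < a i]) => [i /andP[]|none].
  by exists i.
move: pos; rewrite /weight big1 // => i Si.
by have := none i; rewrite /= Si lt0n => /negbFE/eqP.
Qed.

Lemma weight_le_eq a b S : (forall i, i \in S -> a i <= b i) ->
  weight b S <= weight a S -> forall i, i \in S -> a i = b i.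
Proof.
move=> le_ab le_ba i Si; apply/eqP; rewrite eqn_leq le_ab //= leqNgt; apply/negP => lt.
move: le_ba; rewrite (weightD1 a Si) (weightD1 b Si) leqNgt => /negP; apply.
rewrite -addSn leq_add // weight_le // => j /setD1P[_]; exact: le_ab.
Qed.

Definition stable E S := forall k l, k \in S -> l \in S -> [set k; l] \notin E.

Lemma edge_sum_stable E S q a : stable E S -> edge_sum E q a -> weight a S <= q.
Proof.
move=> stS; elim: q a => [|q IHq] a /=.
  by move=> ->; rewrite /weight big1 // => i _; rewrite mnm0E.
move=> [k [l [b [Ekl /IHq le_b ->]]]]; rewrite !weightD !weight1.
suff : ~~ ((k \in S) && (l \in S)) by case: (_ \in _); case: (_ \in _) => //= _; lia.
by apply/andP => -[Sk Sl]; have := stS _ _ Sk Sl; rewrite Ekl.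
Qed.

Lemma edge_sum_nbr E q a k : edge_sum E q a -> a k <= weight a (nbr E k).
Proof.
elim: q a => [|q IHq] a /=; first by move=> ->; rewrite mnm0E.
move=> [u [v [b [Euv /IHq le_b ->]]]]; rewrite !weightD !weight1 !mnmDE !mnm1E.
rewrite leq_add // addnC; apply: leq_add.
  by case: eqP => // <-; rewrite inE setUC Euv.
by case: eqP => // <-; rewrite inE Euv.
Qed.

Lemma bounded_edge_sum_max E S q c w : stable E S ->
  bounded_edge_sum E c q w -> q <= weight c (~: S).
Proof.
move=> stS [Ew le_wc]; have := mdeg_edge_sum Ew; rewrite -(weightC w S).
have := edge_sum_stable stS Ew.
have : weight w (~: S) <= weight c (~: S).
  by apply: weight_le => i _; apply: (mnm_lepP le_wc).
lia.
Qed.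

Lemma bounded_edge_sum_extremal E S c w : stable E S ->
  bounded_edge_sum E c (weight c (~: S)) w ->
  (forall i, i \notin S -> w i = c i) /\ weight w S = weight c (~: S).
Proof.
move=> stS [Ew le_wc]; have := mdeg_edge_sum Ew; rewrite -(weightC w S).
have := edge_sum_stable stS Ew.
have le_wc' i : i \in ~: S -> w i <= c i by move=> _; apply: (mnm_lepP le_wc).
have := weight_le le_wc' => le1 le2 eq_deg; split; last by lia.
by move=> i nSi; apply: (weight_le_eq le_wc'); rewrite ?inE //; lia.
Qed.

End Weights.

Section Realization.
Variables (n : nat) (T : eqType) (pt : 'I_n -> T) (mate : rel 'I_n).
Variable E : {set {set 'I_n}}.
Hypotheses (mate_sym : ssrbool.symmetric mate)
  (mate_uniq : forall k l l', mate k l -> mate k l' -> l = l')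
  (mate_pt : forall k l, mate k l -> pt k != pt l)
  (E_adj : forall k l, ([set k; l] \in E) = (pt k != pt l) && ~~ mate k l).

Definition part_of k : {set 'I_n} := [set i | pt i == pt k].

Definition max_stable (S : {set 'I_n}) : Prop :=
  (exists k, S = part_of k) \/ (exists k l, mate k l /\ S = [set k; l]).

Definition balanced q (a : 'X_{1..n}) : Prop :=
  mdeg a = q.*2 /\ forall S, max_stable S -> weight a S <= q.

Lemma mate_neq k l : mate k l -> k != l.
Proof. by move/mate_pt; apply: contraNneq => ->. Qed.

Lemma max_stable_stable S : max_stable S -> stable E S.
Proof.
case=> [[k ->] u v|[k [l [kl ->]] u v]]; rewrite !inE E_adj.
  by move=> /eqP-> /eqP->; rewrite eqxx.
by move=> /orP[]/eqP-> /orP[]/eqP->; rewrite ?eqxx // ?(mate_sym l) kl andbF.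
Qed.

Section Step.
Variables (q : nat) (a : 'X_{1..n}).
Hypotheses (q_gt0 : 0 < q) (bal : balanced q a).

Lemma weight_outside S : weight a S <= q -> exists2 v, v \notin S & 0 < a v.
Proof.
move=> le_q; have [|v] := @weight_gt0 n a (~: S); last by rewrite inE; exists v.
by have := weightC a S; rewrite bal.1; lia.
Qed.

(* Two disjoint tight sets carry the whole mass of [a]. *)
Lemma tight_disjoint S S' v : q <= weight a S -> weight a S' = q ->
  [disjoint S & S'] -> v \notin S -> 0 < a v -> v \in S'.
Proof.
move=> tS tS' dis nSv av; apply/negPn/negP => nS'v.
have : weight a [set v] <= weight a (~: (S :|: S')).
  by apply: weight_sub; rewrite sub1set !inE negb_or nSv.
have := weightC a (S :|: S'); rewrite weightU // weight_set1 bal.1.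
by lia.
Qed.

Lemma mate_pair_adj k l v : mate k l -> v != k -> v != l ->
  ([set k; v] \in E) || ([set l; v] \in E).
Proof.
move=> kl vk vl; rewrite !E_adj.
have -> : mate k v = false by apply: contraNF vl => /mate_uniq-/(_ _ kl)->.
have -> : mate l v = false.
  by rewrite mate_sym in kl; apply: contraNF vk => /mate_uniq-/(_ _ kl)->.
rewrite !andbT -negb_and; apply: contraTN (mate_pt kl) => /andP[/eqP-> /eqP->].
by rewrite eqxx.
Qed.

Definition hitting k l :=
  forall S, max_stable S -> weight a S = q -> (k \in S) || (l \in S).

Definition good_edge := exists k l,
  [/\ [set k; l] \in E, 0 < a k, 0 < a l & hitting k l].

Lemma good_edge_saturated k : q <= a k -> good_edge.
Proof.
move=> le_qak; have [v nv av] : exists2 v, v \notin part_of k & 0 < a v.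
  by apply/weight_outside/bal.2; left; exists k.
have nkv : ~~ mate k v.
  apply/negP => kv; have mS : max_stable [set k; v] by right; exists k, v.
  by have := bal.2 _ mS; rewrite weight_set2 ?mate_neq //; lia.
exists k, v; split=> //; [|by lia|].
  by rewrite E_adj nkv andbT; move: nv; rewrite inE eq_sym.
move=> S _ tS; case: (boolP (k \in S)) => //= nSk.
apply: (tight_disjoint (S := [set k])) => //; rewrite ?weight_set1 ?disjoints1 //.
by rewrite inE; apply: contraNneq nv => ->; rewrite inE.
Qed.

Hypothesis unsat : forall k, a k < q.

Lemma tight_other S k : weight a S = q -> k \in S -> exists2 v, v \in S :\ k & 0 < a v.
Proof.
move=> tS Sk; apply: weight_gt0; have := unsat k.
by rewrite -tS (weightD1 _ Sk); lia.
Qed.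

Lemma hitting_pair k l u v : mate k l -> a k + a l = q ->
  (u == k) || (u == l) -> v \notin [set k; l] -> 0 < a v ->
  (weight a (part_of k) = q -> (u \in part_of k) || (v \in part_of k)) ->
  (weight a (part_of l) = q -> (u \in part_of l) || (v \in part_of l)) ->
  hitting u v.
Proof.
move=> kl tkl ukl nv av hk hl S mS tS.
have [dis|/pred0Pn[x /andP[/= xkl xS]]] := boolP [disjoint [set k; l] & S].
  rewrite orbC (tight_disjoint (S := [set k; l])) //.
  by rewrite weight_set2 ?mate_neq // tkl.
case: mS tS xS => [[y ->]|[k' [l' [kl' ->]]]] tS.
  have part_eq z : x = z -> x \in part_of y -> part_of y = part_of z.
    by move=> -> /[!inE] /eqP eq_z; apply/setP => i; rewrite !inE eq_z.
  move=> xS; have /orP[/eqP eq_x|/eqP eq_x] : (x == k) || (x == l) by rewrite -in_set2.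
    by move: tS; rewrite (part_eq _ eq_x xS).
  by move: tS; rewrite (part_eq _ eq_x xS).
have pairE y z y' z' : mate y z -> mate y' z' -> y = y' -> [set y; z] = [set y'; z'].
  by move=> yz + eq_y; rewrite -eq_y => /(mate_uniq yz) ->.
have lk : mate l k by rewrite mate_sym.
have lk' : mate l' k' by rewrite mate_sym.
move=> xS; suff <- : [set k; l] = [set k'; l'] by rewrite !inE ukl.
move: xkl xS; rewrite !inE => /orP[]/eqP-> /orP[]/eqP eq_x.
- exact: pairE kl kl' eq_x.
- by rewrite [RHS]setUC; apply: pairE kl lk' eq_x.
- by rewrite setUC; apply: pairE lk kl' eq_x.
- by rewrite setUC [RHS]setUC; apply: pairE lk lk' eq_x.
Qed.

Lemma good_edge_pair_part k l : mate k l -> a k + a l = q ->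
  weight a (part_of k) = q -> good_edge.
Proof.
move=> kl tkl tk; have [|v] := tight_other tk (k := k); first by rewrite inE.
rewrite !inE => /andP[vk /eqP vpt] av.
have lv : v != l by apply: contraTneq (mate_pt kl) => <-; rewrite vpt eqxx.
have := unsat k; have := unsat l => ltl ltk.
exists l, v; split=> //; [|by lia|].
  rewrite E_adj vpt eq_sym (mate_pt kl) /=; apply: contra vk => lv'.
  by rewrite mate_sym in kl; rewrite (mate_uniq lv' kl).
apply: (hitting_pair kl tkl) => //; first by rewrite eqxx orbT.
- by rewrite !inE negb_or vk.
- by rewrite !inE vpt eqxx orbT.
- by rewrite !inE eqxx.
Qed.

Lemma good_edge_unsat : good_edge.
Proof.
have pair_bound k l : mate k l -> a k + a l <= q.
  by move=> kl; rewrite -weight_set2 ?mate_neq //; apply: bal.2; right; exists k, l.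
have [[k [l [kl tkl]]]|npair] := pselect (exists k l, mate k l /\ a k + a l = q).
  have lk : mate l k by rewrite mate_sym.
  have tlk : a l + a k = q by rewrite addnC.
  have [tk|ntk] := eqVneq (weight a (part_of k)) q.
    exact: good_edge_pair_part kl tkl tk.
  have [tl|ntl] := eqVneq (weight a (part_of l)) q.
    exact: good_edge_pair_part lk tlk tl.
  have [|v nv av] := @weight_outside [set k; l].
    by rewrite weight_set2 ?mate_neq ?tkl.
  have := unsat k; have := unsat l => ltl ltk.
  have hit u : (u == k) || (u == l) -> hitting u v.
    move=> ukl; apply: (hitting_pair kl tkl) => // t.
      by case/eqP: ntk.
    by case/eqP: ntl.
  have /orP[Ekv|Elv] : ([set k; v] \in E) || ([set l; v] \in E).
    by move: nv; rewrite !inE negb_or => /andP[]; apply: mate_pair_adj.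
  - by exists k, v; split=> //; [lia | apply: hit; rewrite eqxx].
  - by exists l, v; split=> //; [lia | apply: hit; rewrite eqxx orbT].
have [[t tt]|npart] := pselect (exists t, weight a (part_of t) = q).
  have [|u ut au] := @weight_gt0 n a (part_of t); first by rewrite tt.
  have [v nv av] : exists2 v, v \notin part_of t & 0 < a v.
    by apply: weight_outside; rewrite tt.
  have hit w : w \in part_of t -> hitting w v.
    move=> wt S [[y ->]|[k [l [kl ->]]]] tS; last first.
      by case: npair; exists k, l; rewrite -weight_set2 ?mate_neq.
    have [wy|nwy] := boolP (w \in part_of y) => //=.
    apply: (tight_disjoint (S := part_of t)) => //; first by rewrite tt.
    apply/pred0P => x /=; rewrite !inE; apply/negP => /andP[/eqP xt /eqP xy].
    by move: wt nwy; rewrite !inE -xy xt => ->.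
  have [uv|nuv] := boolP (mate u v); last first.
    exists u, v; split=> //; last exact: hit.
    by rewrite E_adj nuv andbT; move: ut nv; rewrite !inE => /eqP->; rewrite eq_sym.
  have [w] := tight_other tt ut; rewrite !inE => /andP[wu wt] aw.
  exists w, v; split=> //; last by apply: hit; rewrite inE.
  rewrite E_adj; apply/andP; split.
    by move: nv; rewrite inE (eqP wt) eq_sym.
  rewrite mate_sym in uv; apply: contra wu; rewrite mate_sym => vw.
  by rewrite (mate_uniq vw uv).
have hit u v : hitting u v.
  move=> S [[y ->]|[k [l [kl ->]]]] tS; first by case: npart; exists y.
  by case: npair; exists k, l; rewrite -weight_set2 ?mate_neq.
have [u _ au] : exists2 u, u \notin set0 & 0 < a u.
  by apply: weight_outside; rewrite /weight big_set0.
have [v nv av] : exists2 v, v \notin part_of u & 0 < a v.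
  by apply/weight_outside/bal.2; left; exists u.
have [uv|nuv] := boolP (mate u v); last first.
  exists u, v; split=> //; rewrite E_adj nuv andbT.
  by move: nv; rewrite inE eq_sym.
have [w nw aw] : exists2 w, w \notin [set u; v] & 0 < a w.
  by apply/weight_outside/bal.2; right; exists u, v.
have /orP[Euw|Evw] : ([set u; w] \in E) || ([set v; w] \in E).
  by move: nw; rewrite !inE negb_or => /andP[]; apply: mate_pair_adj.
- by exists u, w.
- by exists v, w.
Qed.

End Step.

Lemma balanced_edge_sum q a : balanced q a -> edge_sum E q a.
Proof.
elim: q a => [|q IHq] a bal.
  by apply/eqP; rewrite -mdeg_eq0 bal.1.
have [k [l [Ekl ak al hit]]] : good_edge q.+1 a.
  have [[k]|nsat] := pselect (exists k, q.+1 <= a k).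
    exact: (good_edge_saturated (ltn0Sn q) bal).
  apply: (good_edge_unsat (ltn0Sn q) bal) => k; rewrite ltnNge.
  by apply/negP => lek; apply: nsat; exists k.
have nkl : k != l.
  by apply: contraTneq Ekl => ->; rewrite E_adj eqxx.
have [b def_a] : exists b, a = (U_(k) + U_(l) + b)%MM.
  exists (a - (U_(k) + U_(l)))%MM.
  rewrite addmC submK //; apply/mnm_lepP => i; rewrite mnmDE !mnm1E.
  case: eqP => [<-|_]; last by case: eqP => // <-.
  by rewrite eq_sym (negbTE nkl).
exists k, l, b; split=> //; apply: IHq; split.
  by have := bal.1; rewrite def_a !mdegD !mdeg1 doubleS => -[].
move=> S mS; have := bal.2 S mS; rewrite leq_eqVlt => /orP[/eqP tS|].
  have := hit S mS tS; move: tS; rewrite def_a !weightD !weight1.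
  by case: (k \in S); case: (l \in S) => /= [] eq_q; lia.
by rewrite def_a !weightD; lia.
Qed.

End Realization.

Section Extremal.
Variables (n : nat) (T : eqType) (pt : 'I_n -> T) (mate : rel 'I_n).
Variable E : {set {set 'I_n}}.
Hypotheses (mate_sym : ssrbool.symmetric mate)
  (mate_uniq : forall k l l', mate k l -> mate k l' -> l = l')
  (mate_pt : forall k l, mate k l -> pt k != pt l)
  (E_adj : forall k l, ([set k; l] \in E) = (pt k != pt l) && ~~ mate k l).
Variable c : 'X_{1..n}.
Implicit Types (S : {set 'I_n}) (w : 'X_{1..n}).

Let part := part_of pt.
Let mstable := max_stable pt mate.

Lemma max_stable_part k : mstable (part k).
Proof. by left; exists k. Qed.

Lemma max_stable_pair k l : mate k l -> mstable [set k; l].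
Proof. by right; exists k, l. Qed.

Lemma part_of_eq k x : x \in part k -> part k = part x.
Proof. by rewrite inE => /eqP eq_x; apply/setP => i; rewrite !inE eq_x. Qed.

Lemma mate_pair_eq k l x : mate k l -> x \in [set k; l] ->
  exists2 y, mate x y & [set k; l] = [set x; y].
Proof.
move=> kl; rewrite !inE => /orP[]/eqP->; first by exists l.
by exists k; rewrite 1?mate_sym // setUC.
Qed.

Lemma max_stable_inter S S' x y : mstable S -> mstable S' -> x != y ->
  x \in S -> y \in S -> x \in S' -> y \in S' -> S = S'.
Proof.
have pairP k l : mate k l -> x != y -> x \in [set k; l] -> y \in [set k; l] ->
    mate x y /\ [set k; l] = [set x; y].
  move=> kl xy xkl; have [z xz ->] := mate_pair_eq kl xkl.
  by rewrite !inE eq_sym (negbTE xy) /= => /eqP->.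
have partP k : x \in part k -> y \in part k -> ~~ mate x y.
  rewrite !inE => /eqP xk /eqP yk; apply: contraTN isT => /mate_pt.
  by rewrite xk yk eqxx.
move=> mS mS' xy; case: mS => [[k ->]|[k [l [kl ->]]]] xS yS;
  case: mS' => [[k' ->]|[k' [l' [kl' ->]]]] xS' yS'.
- exact: etrans (part_of_eq xS) (esym (part_of_eq xS')).
- by have [xy' _] := pairP _ _ kl' xy xS' yS'; have := partP _ xS yS; rewrite xy'.
- by have [xy' _] := pairP _ _ kl xy xS yS; have := partP _ xS' yS'; rewrite xy'.
- have [_ ->] := pairP _ _ kl xy xS yS.
  by have [_ ->] := pairP _ _ kl' xy xS' yS'.
Qed.

Lemma nbr_sub S x : mstable S -> x \in S -> nbr E x \subset ~: S.
Proof.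
move=> mS xS; apply/subsetP => y; rewrite !inE; apply: contraTN => yS.
exact: (max_stable_stable mate_sym E_adj mS).
Qed.

Lemma extremal_edge_sum S w : mstable S ->
  (forall i, i \notin S -> w i = c i) -> weight w S = weight c (~: S) ->
  (forall i, i \in S -> w i <= weight c (nbr E i)) ->
  edge_sum E (weight c (~: S)) w.
Proof.
move=> mS wC wS w_nbr.
have eqC S' : S' \subset ~: S -> weight w S' = weight c S'.
  move=> sub; apply: eq_weight => i /(subsetP sub); rewrite inE; exact: wC.
apply: (balanced_edge_sum mate_sym mate_uniq mate_pt E_adj); split.
  by rewrite -(weightC w S) wS eqC // addnn.
move=> S' mS'.
have [dis|/pred0Pn[x /andP[/= xS' xS]]] := boolP [disjoint S' & S].
  have sub : S' \subset ~: S by rewrite subsets_disjoint setCK.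
  by rewrite eqC // weight_sub.
have [eqS|neq] := eqVneq S S'; first by rewrite -eqS wS.
have sub : S' :\ x \subset ~: S.
  apply/subsetP => y /setD1P[yx yS']; rewrite inE; apply: contraNN neq => yS.
  by rewrite (max_stable_inter mS mS' yx).
rewrite (weightD1 _ xS') eqC // (leq_trans (leq_add (w_nbr _ xS) (leqnn _))) //.
rewrite -weightU; first by apply: weight_sub; rewrite subUset sub nbr_sub.
apply/pred0P => y /=; apply/negP => /andP[]; rewrite inE => Exy /setD1P[_ yS'].
by have := max_stable_stable mate_sym E_adj mS' xS' yS'; rewrite Exy.
Qed.

Definition cap (i : 'I_n) : nat := minn (c i) (weight c (nbr E i)).

Lemma extremalP S w : mstable S ->
  bounded_edge_sum E c (weight c (~: S)) w <->
  [/\ forall i, i \notin S -> w i = c i, weight w S = weight c (~: S) &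
      forall i, i \in S -> w i <= cap i].
Proof.
move=> mS; have stS := max_stable_stable mate_sym E_adj mS.
split=> [Bw|[wC wS w_cap]].
  have [wC wS] := bounded_edge_sum_extremal stS Bw; have [Ew le_wc] := Bw.
  split=> // i iS; rewrite leq_min (mnm_lepP le_wc) /=.
  apply: leq_trans (edge_sum_nbr i Ew) _; apply: weight_le => j _.
  exact: (mnm_lepP le_wc).
split; last first.
  apply/mnm_lepP => i; have [/w_cap|/wC->//] := boolP (i \in S).
  by rewrite leq_min => /andP[].
apply: extremal_edge_sum => // i /w_cap.
by rewrite leq_min => /andP[].
Qed.

Lemma exists_weight S (b : 'I_n -> nat) d : d <= \sum_(i in S) b i ->
  exists2 f : 'I_n -> nat, (forall i, f i <= b i) & \sum_(i in S) f i = d.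
Proof.
elim: d => [|d IHd] le_d; first by exists (fun=> 0); rewrite ?big1.
have [f le_f sum_f] := IHd (ltnW le_d).
have [i /andP[iS lt_i]|none] := pickP [pred i in S | f i < b i]; last first.
  move: le_d; rewrite -sum_f ltnNge leq_sum // => i iS.
  by have := none i; rewrite /= iS ltnNge => /negbFE.
exists (fun j => f j + (j == i)) => [j|].
  by case: eqP => [->|_]; rewrite ?addn1 ?addn0.
rewrite big_split /= sum_f (bigD1 i) //= eqxx big1 ?addn1 ?addn0 // => j /andP[_ ne].
by rewrite (negbTE ne).
Qed.

Lemma extremal_exists S : mstable S -> weight c (~: S) <= \sum_(i in S) cap i ->
  exists w, bounded_edge_sum E c (weight c (~: S)) w.
Proof.
move=> mS /exists_weight[f le_f sum_f].
exists [multinom if i \in S then f i else c i | i < n].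
apply/extremalP => //; split=> [i /negbTE iS|/=|i iS].
- by rewrite mnmE iS.
- by rewrite -[RHS]sum_f; apply: eq_bigr => i iS; rewrite mnmE iS.
- by rewrite mnmE iS.
Qed.

Lemma bounded_toric_extremal (K : fieldType) S : mstable S ->
  weight c (~: S) <= \sum_(i in S) cap i ->
  bounded_toric K c E = toric K (bounded_edge_sum E c (weight c (~: S))).
Proof.
move=> mS le; apply: bounded_toricE; first exact: extremal_exists.
by move=> q w; apply/bounded_edge_sum_max/(max_stable_stable mate_sym E_adj mS).
Qed.

(* The exponents outside [S] are constant on the generators, so the ring only
   sees the coordinates in [S], enumerated by [e] and shifted by [s]. *)
Lemma extremal_veronese (K : fieldType) S r (e : 'I_r -> 'I_n) (s : 'I_r -> nat)
    d (f : 'X_{1..r}) :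
  mstable S -> injective e -> S = [set e j | j : 'I_r] ->
  0 < d -> weight c (~: S) = d + \sum_(j < r) s j ->
  (forall j, cap (e j) = s j + f j) ->
  (forall w j, bounded_edge_sum E c (weight c (~: S)) w -> s j <= w (e j)) ->
  alg_iso (toric K (bounded_edge_sum E c (weight c (~: S)))) (veronese K d f).
Proof.
set D := weight c (~: S); move=> mS e_inj eS d_gt0 def_D cap_e s_le.
have e_in j : e j \in S by rewrite eS; apply: imset_f.
have D_gt0 : 0 < D.*2 by rewrite double_gt0 def_D addn_gt0 d_gt0.
have weight_e w : weight w S = \sum_(j < r) w (e j).
  rewrite /weight eS big_imset /=; last by move=> j j' _ _; apply: e_inj.
  exact: eq_bigl.
have not_e i : i \notin S -> [pick j | e j == i] = None.
  move=> nS; case: pickP => // j /eqP ej.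
  by rewrite -ej e_in in nS.
have pick_e j : [pick j' | e j' == e j] = Some j.
  by case: pickP => [j' /eqP/e_inj->//|/(_ j)]; rewrite eqxx.
pose phi (w : 'X_{1..n}) : 'X_{1..r} := [multinom w (e j) - s j | j < r].
pose h (w : 'X_{1..n}) : 'X_{1..r} :=
  [multinom w (e j) - s j * (mdeg w %/ D.*2) | j < r].
pose h' (v : 'X_{1..r}) : 'X_{1..n} :=
  [multinom if [pick j | e j == i] is Some j then v j + s j * (mdeg v %/ d)
            else c i * (mdeg v %/ d) | i < n].
have W_phi w : bounded_edge_sum E c D w ->
    (phi w <= f)%MM /\ \sum_(j < r) phi w j = d.
  move=> Bw; have [wC wS w_cap] := (extremalP w mS).1 Bw; split.
    by apply/mnm_lepP => j; rewrite mnmE leq_subLR -cap_e w_cap.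
  have : \sum_(j < r) phi w j + \sum_(j < r) s j = D.
    rewrite -big_split -[RHS]wS weight_e; apply: eq_bigr => j _ /=.
    by rewrite mnmE subnK // s_le.
  by rewrite def_D => /addIn.
apply: (@toric_alg_iso_gens K n r _ _ phi h h') => [//|v [le_vf sum_v]|sq Wsq].
  pose w : 'X_{1..n} :=
    [multinom if [pick j | e j == i] is Some j then v j + s j else c i | i < n].
  have w_e j : w (e j) = v j + s j by rewrite mnmE pick_e.
  exists w; last by apply/mnmP => j; rewrite mnmE w_e addnK.
  apply/extremalP => //; split=> [i nS|/=|i].
  - by rewrite mnmE not_e.
  - rewrite weight_e (eq_bigr (fun j => v j + s j)) => [|j _]; last exact: w_e.
    by rewrite big_split /= sum_v -/D def_D.
  - rewrite eS => /imsetP[j _ ->]; rewrite w_e cap_e addnC leq_add2l.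
    exact: (mnm_lepP le_vf).
have mdeg_s : mdeg (\sum_(w <- sq) w)%MM = size sq * D.*2.
  rewrite mdeg_sum big_seq (eq_bigr (fun=> D.*2)) => [|w /Wsq[/mdeg_edge_sum] //].
  by rewrite -big_seq big_const_seq count_predT iter_addn_0 mulnC.
have mdeg_phi : mdeg (\sum_(w <- sq) phi w)%MM = size sq * d.
  rewrite mdeg_sum big_seq (eq_bigr (fun=> d)) => [|w /Wsq/W_phi[_]]; last first.
    by rewrite mdegE.
  by rewrite -big_seq big_const_seq count_predT iter_addn_0 mulnC.
have sum_phi j :
    (\sum_(w <- sq) phi w)%MM j + s j * size sq = (\sum_(w <- sq) w)%MM (e j).
  rewrite !mnm_sumE -sum1_size big_distrr -big_split /=.
  rewrite big_seq [RHS]big_seq; apply: eq_bigr => w /Wsq Bw.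
  by rewrite mnmE muln1 subnK // s_le.
split; apply/mnmP => i; rewrite mnmE ?mdeg_s ?mdeg_phi mulnK //.
  by rewrite -sum_phi addnK.
have [|nS] := boolP (i \in S).
  by rewrite eS => /imsetP[j _ ->]; rewrite pick_e sum_phi.
rewrite not_e // mnm_sumE -sum1_size big_distrr /=.
rewrite big_seq [RHS]big_seq; apply: eq_bigr => w /Wsq/(extremalP w mS)[wC _ _].
by rewrite muln1 wC.
Qed.

Lemma nbr_mate k k' : mate k k' -> nbr E k = ~: (k' |: part k).
Proof.
move=> kk'; apply/setP => u; rewrite !inE E_adj negb_or [pt u == _]eq_sym andbC.
congr (_ && _); have [->|ne] := eqVneq u k'; first by rewrite kk'.
by apply: contraNN ne => /mate_uniq-/(_ _ kk')->.
Qed.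

Lemma nbr_free k : (forall l, ~~ mate k l) -> nbr E k = ~: part k.
Proof. by move=> nk; apply/setP => u; rewrite !inE E_adj nk andbT eq_sym. Qed.

Lemma nbr_diff_mate k k' : mate k k' -> nbr E k :\: nbr E k' = part k' :\ k'.
Proof.
move=> kk'; have k'k : mate k' k by rewrite mate_sym.
rewrite (nbr_mate kk') (nbr_mate k'k); apply/setP => u; rewrite !inE negbK negb_or.
have [->|_ /=] := eqVneq u k'; first by rewrite andbF.
have [->|_ /=] := eqVneq u k; first by rewrite eqxx (negbTE (mate_pt kk')).
by case: eqP => //= ->; rewrite eq_sym mate_pt.
Qed.

Lemma part_of_refl k : k \in part k.
Proof. by rewrite inE. Qed.

Section MatePair.
Variables (k k' : 'I_n).
Hypothesis kk' : mate k k'.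
Let P := weight c (nbr E k :\: nbr E k').
Let P' := weight c (nbr E k' :\: nbr E k).
Let O := weight c (~: [set k; k']).

Lemma mate_weight_others : c k + c k' + O = mdeg c.
Proof. by rewrite -weight_set2 ?weightC // (mate_neq mate_pt). Qed.

Lemma mate_weight_part : weight c (part k) = c k + P'.
Proof.
by rewrite /P' nbr_diff_mate 1?mate_sym // (weightD1 _ (part_of_refl k)).
Qed.

Lemma mate_weight_partC : weight c (~: part k) = c k' + weight c (nbr E k).
Proof.
have k'C : k' \in ~: part k by rewrite !inE eq_sym mate_pt.
rewrite (weightD1 _ k'C); congr (_ + weight c _); rewrite (nbr_mate kk').
by apply/setP => u; rewrite !inE negb_or.
Qed.

Lemma mate_weight_nbr : weight c (nbr E k) + P' = O.
Proof.
have := weightC c (part k); rewrite mate_weight_part mate_weight_partC.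
by rewrite -mate_weight_others; lia.
Qed.

Lemma mate_weight_diff : P <= weight c (nbr E k).
Proof. exact/weight_sub/subsetDl. Qed.

Definition star : Prop := [/\ P < c k, P' < c k' & O + 2 <= c k + c k'].

End MatePair.

Section StarPair.
Variables (K : fieldType) (k k' : 'I_n).
Hypotheses (kk' : mate k k') (st : star k k').
Let P := weight c (nbr E k :\: nbr E k').
Let P' := weight c (nbr E k' :\: nbr E k).
Let O := weight c (~: [set k; k']).
Let d := O - P - P'.
Let f : 'X_{1..2} := [multinom of [:: minn (c k - P) d; minn (c k' - P') d]].
Hypothesis d_gt0 : 0 < d.

Lemma star_veronese_type : veronese_type d f.
Proof.
have [lt_P lt_P' le_O] := st.
have f0 : f ord0 = minn (c k - P) d by [].
have f1 : f (lift ord0 ord0) = minn (c k' - P') d by [].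
split=> // [i|]; last by rewrite !big_ord_recl big_ord0 f0 f1; lia.
by have [->|->] : i = ord0 \/ i = lift ord0 ord0; [case: i => [[|[|]]] // ?;
  [left | right]; apply: val_inj | rewrite f0; lia | rewrite f1; lia].
Qed.

Lemma star_veronese : alg_iso (bounded_toric K c E) (veronese K d f).
Proof.
have [lt_P lt_P' le_O] := st; have k'k : mate k' k by rewrite mate_sym.
have nkk' := mate_neq mate_pt kk'.
have mS := max_stable_pair kk'.
have wN : weight c (nbr E k) + P' = O := mate_weight_nbr kk'.
have wN' : weight c (nbr E k') + P = O.
  by rewrite (mate_weight_nbr k'k) setUC.
have cap_k : cap k = P + minn (c k - P) d by rewrite /cap; lia.
have cap_k' : cap k' = P' + minn (c k' - P') d by rewrite /cap; lia.
rewrite (bounded_toric_extremal _ mS); last first.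
  by rewrite big_setU1 ?inE //= big_set1 cap_k cap_k' -/O; lia.
pose e (j : 'I_2) := if j == ord0 then k else k'.
pose s (j : 'I_2) := if j == ord0 then P else P'.
have dec (j : 'I_2) : j = ord0 \/ j = lift ord0 ord0.
  by case: j => [[|[|]]] // ?; [left | right]; apply: val_inj.
apply: (@extremal_veronese K _ _ e s) => //.
- move=> j j'; case: (dec j) => ->; case: (dec j') => -> //= /eqP.
    by rewrite (negbTE nkk').
  by rewrite eq_sym (negbTE nkk').
- apply/setP => i; rewrite !inE; apply/orP/imsetP => [[/eqP->|/eqP->]|[j _ ->]].
  + by exists ord0.
  + by exists (lift ord0 ord0).
  + by rewrite /e; case: ifP => _; rewrite eqxx; [left | right].
- by rewrite !big_ord_recl big_ord0 -/O /s /=; lia.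
- by move=> j; case: (dec j) => ->.
- move=> w j /(extremalP _ mS)[_ + w_cap]; rewrite weight_set2 // -/O.
  have := w_cap k; have := w_cap k'; rewrite !inE !eqxx orbT cap_k cap_k'.
  move=> /(_ isT) + /(_ isT); case: (dec j) => ->; rewrite /s /e /=; lia.
Qed.

End StarPair.

Section NoStar.
Hypothesis no_star : forall k k', mate k k' -> ~ star k k'.

Lemma part_cap_sum k0 : weight c (~: part k0) + 2 <= weight c (part k0) ->
  weight c (~: part k0) <= \sum_(i in part k0) cap i.
Proof.
move=> heavy; have cap_le i : i \in part k0 -> cap i != c i ->
    cap i = weight c (nbr E i).
  by move=> _; rewrite /cap; lia.
have [k /andP[kS ck]|all_c] := pickP [pred i in part k0 | cap i != c i]; last first.
  have -> : \sum_(i in part k0) cap i = weight c (part k0).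
    by apply: eq_bigr => i iS; apply/eqP; have := all_c i; rewrite /= iS => /negbFE.
  by lia.
have cap_k := cap_le k kS ck; rewrite (part_of_eq kS) in heavy cap_le *.
rewrite (big_setD1 k) ?part_of_refl //= cap_k.
have [[k' kk']|nk] := pselect (exists k', mate k k'); last first.
  rewrite nbr_free ?leq_addr // => l; apply/negP => kl.
  by apply: nk; exists l.
have [l /andP[lS cl]|all_c] := pickP [pred i in part k :\ k | cap i != c i].
  have /setD1P[lk lP] := lS.
  rewrite (big_setD1 l) //= (cap_le l lP cl).
  have [[l' ll']|nl] := pselect (exists l', mate l l'); last first.
    rewrite (nbr_free (k := l)) -?(part_of_eq lP) => [|l']; first by lia.
    by apply/negP => ll'; apply: nl; exists l'.
  have := mate_weight_partC kk'; have := mate_weight_partC ll'.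
  rewrite -(part_of_eq lP) => eq_l eq_k.
  have k'l' : k' != l'.
    apply: contraNneq lk => eq_l'; rewrite mate_sym -eq_l' in ll'.
    by rewrite mate_sym in kk'; rewrite (mate_uniq kk' ll').
  have : weight c [set k'; l'] <= weight c (~: part k).
    apply: weight_sub; rewrite subUset !sub1set !inE eq_sym mate_pt //=.
    have /eqP <- : pt l == pt k by rewrite inE in lP.
    by rewrite eq_sym mate_pt.
  by rewrite weight_set2 //; lia.
have -> : \sum_(i in part k :\ k) cap i = weight c (part k :\ k).
  apply: eq_bigr => i iS; apply/eqP; have := all_c i.
  by rewrite /= iS => /negbFE.
have := no_star kk'; rewrite /star.
have := mate_weight_partC kk'; have := mate_weight_part kk'.
have := mate_weight_nbr kk'; have := mate_weight_diff k k'.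
have := weightD1 c (part_of_refl k).
have : weight c (nbr E k) <= c k by rewrite -cap_k; apply: geq_minl.
have : weight c (nbr E k) != c k by rewrite -cap_k.
move: heavy.
set P := weight c (nbr E k :\: nbr E k'); set P' := weight c (nbr E k' :\: nbr E k).
move=> heavy ne le1 wp le2 eO ep eC nst; rewrite leqNgt; apply/negP => lt.
by apply: nst; split; lia.
Qed.

Lemma max_stable_near S : (forall i, weight c (part i) < weight c (~: part i) + 2) ->
  mstable S -> (weight c S).*2 <= mdeg c + 1.
Proof.
move=> light; case=> [[i ->]|[k [k' [kk' ->]]]].
  by rewrite -/(part i); have := light i; have := weightC c (part i); lia.
have k'k : mate k' k by rewrite mate_sym.
have := weightC c [set k; k']; rewrite weight_set2 ?(mate_neq mate_pt) //.
have := no_star kk'; rewrite /star => nst eqC; rewrite leqNgt; apply/negP => lt.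
apply: nst; have := light k; have := light k'.
have := mate_weight_part kk'; have := mate_weight_part k'k.
have := mate_weight_partC kk'; have := mate_weight_partC k'k.
have := mate_weight_nbr kk'; have := mate_weight_nbr k'k; rewrite (setUC [set k']).
move: lt eqC; do 9!move: (weight _ _) => ?; move: (mdeg c) (c k) (c k') => C x y.
by clear; split; lia.
Qed.

End NoStar.

Section Polynomial.
Variables (K : fieldType) (q : nat).
Hypothesis q_gt0 : 0 < q.

Lemma mdeg_sub_bounded w : (w <= c)%MM -> mdeg (c - w)%MM + mdeg w = mdeg c.
Proof. by move=> le_wc; rewrite -mdegD submK. Qed.

Lemma mdeg_sum_bounded s : (forall w, w \in s -> bounded_edge_sum E c q w) ->
  mdeg (\sum_(w <- s) w)%MM = size s * q.*2.
Proof.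
move=> Ws; rewrite mdeg_sum big_seq.
rewrite (eq_bigr (fun=> q.*2)) => [|w /Ws[/mdeg_edge_sum] //].
by rewrite -big_seq big_const_seq count_predT iter_addn_0 mulnC.
Qed.

Lemma bounded_toric_even : mdeg c = q.*2 -> edge_sum E q c ->
  alg_iso (bounded_toric K c E) {mpoly K[1]}.
Proof.
move=> deg_c Ec.
have W_eq w : bounded_edge_sum E c q w -> w = c.
  move=> [/mdeg_edge_sum deg_w le_wc]; have := mdeg_sub_bounded le_wc.
  rewrite deg_c deg_w -[RHS]add0n => /addIn/eqP; rewrite mdeg_eq0 => /eqP eq0.
  by rewrite -[RHS](submK le_wc) eq0 add0m.
rewrite (@bounded_toricE n E K c q); first last.
- move=> q' w [/mdeg_edge_sum deg_w /mdeg_sub_bounded].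
  by rewrite deg_c deg_w => /eqP; rewrite -leq_double => /eqP <-; apply: leq_addl.
- by exists c; split=> //; apply: lepm_refl.
apply: alg_iso_trans (toric_vars_alg_iso K 1).
apply: (@toric_alg_iso_gens K n 1 _ _ (fun=> U_(ord0)%MM)
  (fun m => U_(ord0) *+ (mdeg m %/ q.*2))%MM (fun v => c *+ v ord0)%MM).
- by move=> w _; exists ord0.
- move=> w' [i ->]; exists c; first by split=> //; apply: lepm_refl.
  by congr (U_(_))%MM; apply: ord1.
move=> s Ws; rewrite mdeg_sum_bounded // mulnK ?double_gt0 //.
have sumU : (\sum_(w <- s) U_(ord0) = U_(ord0) *+ size s :> 'X_{1..1})%MM.
  by rewrite big_const_seq count_predT; elim: (size s) => //= k ->; rewrite mulmS.
rewrite sumU; split=> //.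
rewrite mulmnE mnm1E eqxx mul1n; elim: s Ws {sumU} => [|w s IHs] Ws.
  by rewrite big_nil.
rewrite /= mulmS IHs => [|u su]; last by apply: Ws; rewrite inE su orbT.
by rewrite big_cons (W_eq w) //; apply: Ws; rewrite inE eqxx.
Qed.

Definition droppable : {set 'I_n} := [set k | `[< edge_sum E q (c - U_(k))%MM >]].

Hypothesis c_gt0 : forall k, 0 < c k.

Lemma sub1_le k : (U_(k) <= c)%MM.
Proof. by apply/mnm_lepP => i; rewrite mnm1E; case: eqP => // <-. Qed.

Lemma bounded_odd w : mdeg c = q.*2.+1 -> bounded_edge_sum E c q w ->
  exists2 k, k \in droppable & (c - w = U_(k))%MM.
Proof.
move=> deg_c [Ew le_wc]; have := mdeg_sub_bounded le_wc.
rewrite deg_c (mdeg_edge_sum Ew) -add1n => /addIn/eqP/mdeg1P[k /eqP def_k].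
exists k => //; rewrite inE; apply/asboolP.
by rewrite -def_k submBA // addmC addmK.
Qed.

Lemma droppable_bounded k : k \in droppable -> bounded_edge_sum E c q (c - U_(k))%MM.
Proof. by rewrite inE => /asboolP Ek; split=> //; apply: lem_subr. Qed.

Lemma bounded_toric_odd : mdeg c = q.*2.+1 -> droppable != set0 ->
  alg_iso (bounded_toric K c E) {mpoly K[#|droppable|]}.
Proof.
move=> deg_c /set0Pn[k0 Dk0].
have Dval (i : 'I_(#|droppable|)) : enum_val i \in droppable := enum_valP i.
rewrite (@bounded_toricE n E K c q); first last.
- move=> q' w [/mdeg_edge_sum deg_w /mdeg_sub_bounded].
  by rewrite deg_c deg_w; lia.
- by exists (c - U_(k0))%MM; apply: droppable_bounded.
apply: alg_iso_trans (toric_vars_alg_iso K _).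
pose phi (w : 'X_{1..n}) : 'X_{1..#|droppable|} :=
  [multinom c (enum_val i) - w (enum_val i) | i < #|droppable|].
pose h (m : 'X_{1..n}) : 'X_{1..#|droppable|} :=
  [multinom c (enum_val i) * (mdeg m %/ q.*2) - m (enum_val i) | i < #|droppable|].
pose h' (v : 'X_{1..#|droppable|}) : 'X_{1..n} :=
  [multinom c k * mdeg v - \sum_i (enum_val i == k) * v i | k < n].
have phiE w i : phi w i = (c - w)%MM (enum_val i) by rewrite !mnmE.
have phiU w k (Dk : k \in droppable) : (c - w = U_(k))%MM ->
    phi w = U_(enum_rank_in Dk k)%MM.
  move=> eq_k; apply/mnmP => i; rewrite phiE eq_k !mnm1E; congr (nat_of_bool _).
  by rewrite -{1}(enum_rankK_in Dk Dk) (inj_eq enum_val_inj).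
apply: (@toric_alg_iso_gens K n _ _ _ phi h h').
- by move=> w /(bounded_odd deg_c)[k Dk /(phiU _ _ Dk)->]; exists (enum_rank_in Dk k).
- move=> _ [i ->]; exists (c - U_(enum_val i))%MM; first exact: droppable_bounded.
  rewrite (phiU _ _ (Dval i)) ?enum_valK_in //.
  by rewrite submBA ?sub1_le // addmC addmK.
move=> s Ws.
have mdeg_phi : mdeg (\sum_(w <- s) phi w)%MM = size s.
  rewrite mdeg_sum big_seq (eq_bigr (fun=> 1)) => [|w /Ws/(bounded_odd deg_c)[k Dk]].
    by rewrite -big_seq sum1_size.
  by move/(phiU _ _ Dk)->; rewrite mdeg1.
have sum_sub k : (\sum_(w <- s) (c - w))%MM k = c k * size s - (\sum_(w <- s) w)%MM k.
  have -> : c k * size s = (\sum_(w <- s) (c - w))%MM k + (\sum_(w <- s) w)%MM k.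
    rewrite -mnmDE -big_split /= -sum1_size big_distrr mnm_sumE /=.
    rewrite big_seq [RHS]big_seq; apply: eq_bigr => w /Ws[_ le_wc].
    by rewrite submK // muln1.
  by rewrite addnK.
have sum_le k : (\sum_(w <- s) w)%MM k <= c k * size s.
  rewrite mnm_sumE -sum1_size big_distrr /= big_seq [leqRHS]big_seq.
  by apply: leq_sum => w /Ws[_ /mnm_lepP]; rewrite muln1.
have sum_phi i : (\sum_(w <- s) phi w)%MM i = (\sum_(w <- s) (c - w))%MM (enum_val i).
  by rewrite !mnm_sumE; apply: eq_bigr => w _; rewrite phiE.
split; apply/mnmP => k.
  by rewrite mnmE sum_phi sum_sub mdeg_sum_bounded // mulnK ?double_gt0.
rewrite mnmE mdeg_phi; suff -> : \sum_i (enum_val i == k) * (\sum_(w <- s) phi w)%MM i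
    = (\sum_(w <- s) (c - w))%MM k by rewrite sum_sub subKn.
have [Dk|nDk] := boolP (k \in droppable).
  rewrite (bigD1 (enum_rank_in Dk k)) //= sum_phi enum_rankK_in // eqxx mul1n.
  rewrite [X in _ + X]big1 ?addn0 // => i ne; case: eqP => // eq_k.
  by case/eqP: ne; apply: enum_val_inj; rewrite enum_rankK_in.
rewrite [LHS]big1 => [|i _]; last by case: eqP => // eq_k; rewrite -eq_k Dval in nDk.
rewrite mnm_sumE big_seq big1 // => w /Ws/(bounded_odd deg_c)[l Dl ->].
by rewrite mnm1E; case: eqP => // eq_l; rewrite -eq_l Dl in nDk.
Qed.

End Polynomial.

Lemma tight_meet q S S' : mdeg c = q.*2.+1 -> q < weight c S -> q < weight c S' ->
  exists2 x, x \in S & x \in S'.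
Proof.
move=> deg_c tS tS'; have [dis|/pred0Pn[x /andP[/=]]] := boolP [disjoint S & S'].
  have := weightC c (S :|: S'); rewrite weightU // deg_c; lia.
by exists x.
Qed.

Lemma drop_vertex q : mdeg c = q.*2.+1 -> 0 < q ->
  exists k, forall S, mstable S -> q < weight c S -> k \in S.
Proof.
move=> deg_c q_gt0.
have weightT : q < weight c setT.
  by have := weightC c setT; rewrite setCT /weight big_set0 deg_c; lia.
have [A tA partA] : exists2 A, q < weight c A &
    forall k, q < weight c (part k) -> part k = A.
  have [[k tk]|nt] := pselect (exists k, q < weight c (part k)); last first.
    by exists setT => // k tk; case: nt; exists k.
  exists (part k) => // l tl; have [x xl xk] := tight_meet deg_c tl tk.
  exact: etrans (part_of_eq xl) (esym (part_of_eq xk)).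
have [B tB pairB] : exists2 B, q < weight c B &
    forall k l, mate k l -> q < weight c [set k; l] -> [set k; l] = B.
  have [[k [l [kl tkl]]]|nt] :=
    pselect (exists k l, mate k l /\ q < weight c [set k; l]); last first.
    by exists setT => // k l kl tkl; case: nt; exists k, l.
  exists [set k; l] => // k' l' kl' tkl'.
  have [x xkl' xkl] := tight_meet deg_c tkl' tkl.
  have [y xy ->] := mate_pair_eq kl' xkl'.
  by have [z xz ->] := mate_pair_eq kl xkl; rewrite (mate_uniq xy xz).
have [k kA kB] := tight_meet deg_c tA tB.
exists k => S [[l ->]|[l [l' [ll' ->]]]] tS; first by move: kA; rewrite -(partA l tS).
by rewrite (pairB l l').
Qed.

Lemma bounded_toric_polynomial (K : fieldType) :
  (forall k, 0 < c k) -> (forall k k', mate k k' -> ~ star k k') ->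
  (forall i, weight c (part i) < weight c (~: part i) + 2) -> 1 < mdeg c ->
  exists2 v, v <= n & alg_iso (bounded_toric K c E) {mpoly K[v]}.
Proof.
move=> c_gt0 no_star light deg_gt1; pose q := (mdeg c)./2.
have near S := max_stable_near no_star light (S := S).
have q_gt0 : 0 < q by rewrite half_gt0.
have balE := balanced_edge_sum mate_sym mate_uniq mate_pt E_adj.
have := odd_double_half (mdeg c); rewrite -/q; case: (odd (mdeg c)) => deg_c.
  have [k kS] := drop_vertex (esym deg_c) q_gt0.
  have Dk : k \in droppable q.
    rewrite inE; apply/asboolP/balE; split.
      by have := mdeg_sub_bounded (sub1_le c_gt0 k); rewrite mdeg1 -deg_c addn1 => -[].
    move=> S mS; have [tS|] := ltnP q (weight c S).
      have := near S mS; rewrite -{1}(submK (sub1_le c_gt0 k)) weightD weight1.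
      by rewrite kS // -deg_c; lia.
    by rewrite -{1}(submK (sub1_le c_gt0 k)) weightD; lia.
  exists #|droppable q|; first by rewrite -[leqRHS]card_ord max_card.
  by apply: bounded_toric_odd => //; apply/set0Pn; exists k.
exists 1; first by case: (n) (c) deg_gt1 => // c0; rewrite mdegE big_ord0.
apply: (bounded_toric_even _ q_gt0 (esym deg_c)); apply: balE; split=> [//|S mS].
by have := near S mS; rewrite -deg_c; lia.
Qed.

End Extremal.

(** * Complete multipartite graphs *)

Section MultipartiteParts.
Variables (m : nat) (ns : 'I_m -> nat).
Local Notation V := 'I_(\sum_(j < m) ns j).

Definition part_index (k : V) : 'I_m := tagnat.sig1 k.

Lemma part_vertexE (i : 'I_m) (h : 'I_(ns i)) : part_vertex h = tagnat.Rank i h.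
Proof. exact/val_inj/esym/tagnat.RankEsum. Qed.

Lemma part_index_vertex (i : 'I_m) (h : 'I_(ns i)) : part_index (part_vertex h) = i.
Proof. by rewrite part_vertexE /part_index tagnat.Rank1K. Qed.

Lemma part_vertex_inj (i : 'I_m) : injective (@part_vertex m ns i).
Proof. by move=> h h' /(congr1 val)/= /addnI/val_inj. Qed.

Lemma mem_part (i : 'I_m) k : (k \in part ns i) = (part_index k == i).
Proof.
apply/imsetP/eqP => [[h _ ->]|<-]; first exact: part_index_vertex.
by exists (tagnat.sig2 k); rewrite // part_vertexE tagnat.sig2K.
Qed.

Lemma multipartite_edgesE k l :
  ([set k; l] \in multipartite_edges ns) = (part_index k != part_index l).
Proof.
have ltE u v : part_index u < part_index v -> [set u; v] \in multipartite_edges ns.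
  move=> lt_uv; apply/bigcupP; exists (part_index u) => //.
  apply/bigcupP; exists (part_index v) => //.
  by apply: imset2_f; rewrite mem_part.
apply/idP/idP => [/bigcupP[i _ /bigcupP[j lt_ij /imset2P[u v]]]|].
  rewrite !mem_part => /eqP ui /eqP vj eq_kl; apply/negP => /eqP eq_pt.
  have uv : u \in [set k; l] /\ v \in [set k; l] by rewrite eq_kl !inE !eqxx orbT.
  have eq_u : part_index u = part_index k by case: uv => /set2P[]->.
  have eq_v : part_index v = part_index k by case: uv => _ /set2P[]->.
  by move: lt_ij; rewrite -ui -vj eq_u eq_v ltnn.
rewrite neq_ltn => /orP[/ltE//|/ltE]; by rewrite setUC.
Qed.

Lemma part_part_of (i : 'I_m) k : part_index k = i -> part ns i = part_of part_index k.
Proof. by move=> <-; apply/setP => u; rewrite mem_part inE. Qed.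

Lemma weight_other_parts (c : 'X_{1..\sum_(j < m) ns j}) (i : 'I_m) :
  \sum_(j < m | j != i) \sum_(h in part ns j) c h = weight c (~: part ns i).
Proof.
rewrite /weight (partition_big part_index (fun j => j != i)) => [|k]; last first.
  by rewrite inE mem_part.
apply: eq_bigr => j ji; apply: eq_bigl => k; rewrite inE !mem_part.
by case: eqP => [->|]; rewrite ?ji ?andbF.
Qed.

End MultipartiteParts.

Theorem theorem4p1 (K : fieldType) (m : nat) (ns : 'I_m -> nat)
    (M : {set {set 'I_(\sum_(j < m) ns j)}}) (c : 'X_{1..\sum_(j < m) ns j})
    (m_ge2 : 2 <= m) (ns_gt0 : forall i, 0 < ns i)
    (M_matching : matching (multipartite_edges ns) M)
    (G_no_isolated :
      forall k, nbr (multipartite_edges ns :\: M) k != set0)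
    (c_gt0 : forall k, 0 < c k) :
  let n := \sum_(j < m) ns j in
  let G := multipartite_edges ns :\: M in
  let N := nbr G in
  let ell (i : 'I_m) := \sum_(h in part ns i) c h in
  let ell' (i : 'I_m) := \sum_(j < m | j != i) ell j in
  let dd (k : 'I_n) := minn (c k) (\sum_(l in N k) c l) in
  let others (k k' : 'I_n) := \sum_(t | (t != k) && (t != k')) c t in
  let priv (k k' : 'I_n) := \sum_(t in N k :\: N k') c t in
  let star (k k' : 'I_n) :=
    [/\ priv k k' < c k, priv k' k < c k' & others k k' + 2 <= c k + c k'] in
  (* alpha *)
  (forall k k' : 'I_n, [set k; k'] \in M -> star k k' ->
     let d := others k k' - priv k k' - priv k' k in
     let f := [multinom of [:: minn (c k - priv k k') d;
                               minn (c k' - priv k' k) d]] in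
     (* d = 0 happens only for m = 2, where A(d; f) is not defined *)
     0 < d ->
     veronese_type d f /\ alg_iso (bounded_toric K c G) (veronese K d f))
  /\
  (* beta *)
  ((forall k k' : 'I_n, [set k; k'] \in M -> ~ star k k') ->
     ((forall i, ell i < ell' i + 2) ->
        (exists2 v, v <= n & alg_iso (bounded_toric K c G) {mpoly K[v]}) /\
        gorenstein (bounded_toric K c G))
     /\
     (forall i, ell' i + 2 <= ell i ->
        let b := [multinom dd (part_vertex h) | h < ns i] in
        veronese_type (ell' i) b /\
        alg_iso (bounded_toric K c G) (veronese K (ell' i) b))).
Proof.
move=> n G N ell ell' dd others priv str.
pose pt := @part_index m ns; pose mate k l := [set k; l] \in M.
have [M_sub M_triv] := andP M_matching.
have mate_sym : ssrbool.symmetric mate by move=> k l; rewrite /mate setUC.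
have mate_pt k l : mate k l -> pt k != pt l.
  by move/(subsetP M_sub); rewrite multipartite_edgesE.
have mate_uniq k l l' : mate k l -> mate k l' -> l = l'.
  move=> kl kl'; have lk := mate_neq mate_pt kl; rewrite eq_sym in lk.
  have eq_set : [set k; l] = [set k; l'].
    apply/eqP/negPn/negP => /(trivIsetP M_triv _ _ kl kl')/pred0P/(_ k).
    by rewrite /= !inE eqxx.
  have : l \in [set k; l'] by rewrite -eq_set !inE eqxx orbT.
  by rewrite !inE (negbTE lk) => /eqP.
have E_adj k l : ([set k; l] \in G) = (pt k != pt l) && ~~ mate k l.
  by rewrite inE multipartite_edgesE andbC.
have othersE k k' : others k k' = weight c (~: [set k; k']).
  by apply: eq_bigl => t; rewrite !inE negb_or.
have starE k k' : star G c k k' -> str k k'.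
  by case=> *; split; rewrite ?othersE.
have starE' k k' : str k k' -> star G c k k'.
  by case=> + + +; rewrite othersE; split.
split=> [k k' kk' st|no_star].
  move=> d f; have def_d : d = weight c (~: [set k; k']) - priv k k' - priv k' k.
    by rewrite /d othersE.
  rewrite /f {f}; rewrite def_d => d_gt0; split.
    exact: (star_veronese_type kk' (starE' _ _ st) d_gt0).
  exact: (star_veronese mate_sym mate_uniq mate_pt E_adj K kk' (starE' _ _ st) d_gt0).
have vertex (i : 'I_m) : exists k, part ns i = part_of pt k.
  exists (part_vertex (Ordinal (ns_gt0 i))).
  by apply: part_part_of; rewrite part_index_vertex.
have no_star' k k' : mate k k' -> ~ star G c k k' by move=> /no_star ns' /starE.
have deg_c : 1 < mdeg c.
  have [i0 [i1 ne]] : exists i0 i1 : 'I_m, i0 != i1.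
    by exists (Ordinal (ltnW m_ge2)), (Ordinal m_ge2).
  pose x i := part_vertex (Ordinal (ns_gt0 i)).
  have nx : x i0 != x i1.
    by apply: contraNneq ne => /(congr1 pt); rewrite /pt !part_index_vertex => ->.
  rewrite -(weightC c [set x i0; x i1]) weight_set2 // ltn_addr //.
  exact: (leq_add (c_gt0 (x i0)) (c_gt0 (x i1))).
split=> [light|i heavy b].
  suff iso : exists2 v, v <= n & alg_iso (bounded_toric K c G) {mpoly K[v]}.
    by split=> //; have [v _] := iso; apply: gorenstein_alg_iso_mpoly.
  apply: (bounded_toric_polynomial mate_sym mate_uniq mate_pt E_adj) => // k.
  have := light (pt k); rewrite /ell' weight_other_parts /ell.
  by rewrite (part_part_of (k := k)).
have [k0 eq_part] := vertex i.
have ell'E : ell' i = weight c (~: part_of pt k0).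
  by rewrite /ell' weight_other_parts eq_part.
have mS : max_stable pt mate (part_of pt k0) := max_stable_part pt mate k0.
have le_cap : weight c (~: part_of pt k0) <= \sum_(j in part_of pt k0) cap G c j.
  apply: (part_cap_sum mate_sym mate_uniq mate_pt E_adj) => //.
  by rewrite -ell'E; move: heavy; rewrite /ell eq_part.
have b_cap h : b h = cap G c (part_vertex h) by rewrite mnmE.
have nbr_gt0 k : 0 < weight c (nbr G k).
  by have /set0Pn[l kl] := G_no_isolated k; rewrite (weightD1 c kl) ltn_addr.
have nbr_le k : k \in part_of pt k0 -> weight c (nbr G k) <= ell' i.
  by move=> k_part; rewrite ell'E weight_sub // (nbr_sub mate_sym E_adj mS).
have ell'_gt0 : 0 < ell' i.
  by apply: leq_trans (nbr_gt0 k0) (nbr_le _ (part_of_refl pt k0)).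
split.
  split=> // [h|].
    have k_part : part_vertex h \in part_of pt k0 by rewrite -eq_part imset_f.
    by rewrite b_cap leq_min c_gt0 nbr_gt0 geq_min nbr_le ?orbT.
  rewrite ell'E; apply: leq_trans le_cap _; rewrite -eq_part big_imset /=.
    by apply/eq_leq/eq_big => [//|h _]; rewrite b_cap.
  by move=> h h' _ _; apply: part_vertex_inj.
rewrite (bounded_toric_extremal mate_sym mate_uniq mate_pt E_adj K mS le_cap) ell'E.
apply: (@extremal_veronese _ _ pt mate G mate_sym mate_uniq mate_pt E_adj c K _ _
  (@part_vertex m ns i) (fun=> 0)) => //.
- exact: (@part_vertex_inj m ns i).
- by rewrite -ell'E.
- by rewrite [X in _ + X]big1 ?addn0.
- by move=> h; rewrite b_cap.
Qed.
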